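(* Let $m,n,N$ be non-negative integers, let $x=(x_1,\dots,x_n)$ and $y=(y_1,\dots,y_N)$ be variables, and let $f(x,y)=(f_1(x,y),\dots,f_m(x,y))\in\mathbb{K}\{x,y\}^m$ be convergent power series. Suppose that $\bar y(x)=(\bar y_1(x),\dots,\bar y_N(x))\in\mathbb{K}[[x]]^N$ is a sequence of formal power series without constant term such that $$f(x,\bar y(x))=0.$$ Then there exist an integer $s\ge 0$, new variables $t=(t_1,\dots,t_s)$, a sequence of convergent power series $y(x,t)=(y_1(x,t),\dots,y_N(x,t))\in\mathbb{K}\{x,t\}^N$ with $y(0,0)=0$, and a sequence of formal power series $\bar t(x)=(\bar t_1(x),\dots,\bar t_s(x))\in\mathbb{K}[[x]]^s$ with $\bar t(0)=0$, such that $$f(x,y(x,t))=0\quad\text{and}\quad \bar y(x)=y(x,\bar t(x)).$$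
   Context: $\mathbb{K}$ is a field of characteristic zero with a non-trivial valuation (a non-trivial real-valued absolute value $|\cdot|$). For variables $z=(z_1,\dots,z_k)$, $\mathbb{K}[[z]]$ is the ring of formal power series in $z$ with coefficients in $\mathbb{K}$, and $\mathbb{K}\{z\}$ is its subring of convergent power series (those $\sum_\alpha a_\alpha z^\alpha$ for which $\sum_\alpha |a_\alpha| r^{|\alpha|}<\infty$ for some real $r>0$). Substitution of power series without constant term into a power series is the usual formal substitution. *)

(* Defs.v *)
From HB Require Import structures.
From mathcomp Require Import all_boot all_order all_algebra.
From mathcomp Require Import mpoly.
From mathcomp Require Import boolp classical_sets reals ereal esum.

Set Implicit Arguments.
Unset Strict Implicit.
Unset Printing Implicit Defensive.

Import Order.TTheory GRing.Theory Num.Theory.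
Local Open Scope ring_scope.

Record absolute_value (R : realType) (K : fieldType) (v : K -> R) : Prop := {
  absv_ge0 : forall a, 0 <= v a;
  absv_eq0 : forall a, v a = 0 <-> a = 0;
  absvM : forall a b, v (a * b) = v a * v b;
  absvD : forall a b, v (a + b) <= v a + v b
}.

Definition nontrivial_absolute_value (R : realType) (K : fieldType)
    (v : K -> R) : Prop :=
  absolute_value v /\ exists2 a, a != 0 & v a != 1.

(** [mps n K] is K[[z_1, ..., z_n]]: a series is its family of coefficients,
    indexed by the multi-indices ['X_{1..n}]. *)
Record mps (n : nat) (K : Type) := MPS { mps_coef :> 'X_{1..n} -> K }.

HB.instance Definition _ n (K : Type) := gen_eqMixin (mps n K).
HB.instance Definition _ n (K : Type) := gen_choiceMixin (mps n K).

Lemma mpsP n (K : Type) (f g : mps n K) : (forall a, f a = g a) -> f = g.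
Proof. by case: f g => [f] [g] /= fg; congr MPS; apply/funext. Qed.

Section Ring.
Variables (n : nat) (K : comNzRingType).
Implicit Types (f g h : mps n K) (a : 'X_{1..n}).

Definition mps_zero : mps n K := MPS (fun=> 0).
Definition mps_opp f : mps n K := MPS (fun a => - f a).
Definition mps_add f g : mps n K := MPS (fun a => f a + g a).

Fact mps_addA : associative mps_add.
Proof. by move=> f g h; apply: mpsP => a /=; rewrite addrA. Qed.
Fact mps_addC : commutative mps_add.
Proof. by move=> f g; apply: mpsP => a /=; rewrite addrC. Qed.
Fact mps_add0 : left_id mps_zero mps_add.
Proof. by move=> f; apply: mpsP => a /=; rewrite add0r. Qed.
Fact mps_addN : left_inverse mps_zero mps_opp mps_add.
Proof. by move=> f; apply: mpsP => a /=; rewrite addNr. Qed.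

HB.instance Definition _ :=
  GRing.isZmodule.Build (mps n K) mps_addA mps_addC mps_add0 mps_addN.

Definition mps_one : mps n K := MPS (fun a => (a == 0%MM)%:R).

(** Cauchy product; the degree bounds only make the index type finite. *)
Definition mps_mul f g : mps n K := MPS (fun a =>
  \sum_(b : 'X_{1..n < (mdeg a).+1, (mdeg a).+1} | a == (b.1 + b.2)%MM)
     f b.1 * g b.2).

Definition mps_trunc d f : {mpoly K[n]} :=
  \sum_(a : 'X_{1..n < d}) f a *: 'X_[a].

Lemma mps_truncE d f a : (mdeg a < d)%N -> (mps_trunc d f)@_a = f a.
Proof. exact: mcoeff_mpoly. Qed.

Lemma mcoeffM_eq (p p' q q' : {mpoly K[n]}) a :
    (forall b, (mdeg b <= mdeg a)%N -> p@_b = p'@_b) ->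
    (forall b, (mdeg b <= mdeg a)%N -> q@_b = q'@_b) ->
  (p * q)@_a = (p' * q')@_a.
Proof.
by move=> pp' qq'; rewrite !mcoeffM; apply: eq_bigr => -[b c] _ /=;
  rewrite pp' ?qq' // -ltnS bmdeg.
Qed.

Lemma mps_mulE d f g a : (mdeg a < d)%N ->
  mps_mul f g a = (mps_trunc d f * mps_trunc d g)@_a.
Proof.
move=> ad; rewrite mcoeffM /=; apply: eq_bigr => -[b c] _ /=.
by rewrite !mps_truncE //; apply: leq_trans (bmdeg _) ad.
Qed.

Fact mps_mulA : associative mps_mul.
Proof.
move=> f g h; apply: mpsP => a; set d := (mdeg a).+1.
rewrite (@mps_mulE d) // [RHS](@mps_mulE d) //.
pose F := mps_trunc d f; pose G := mps_trunc d g; pose H := mps_trunc d h.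
transitivity ((F * (G * H))@_a).
  apply: mcoeffM_eq => // b ba.
  by rewrite mps_truncE // (@mps_mulE d).
rewrite mulrA; apply: mcoeffM_eq => // b ba.
by rewrite mps_truncE // (@mps_mulE d).
Qed.

Fact mps_mulC : commutative mps_mul.
Proof.
by move=> f g; apply: mpsP => a; rewrite !(@mps_mulE (mdeg a).+1) // mulrC.
Qed.

Fact mps_mul1 : left_id mps_one mps_mul.
Proof.
move=> f; apply: mpsP => a; rewrite (@mps_mulE (mdeg a).+1) //.
rewrite -[RHS](@mps_truncE (mdeg a).+1) // -[in RHS](mul1r (mps_trunc _ _)).
by apply: mcoeffM_eq => // b ba; rewrite mps_truncE // mcoeff1.
Qed.

Fact mps_mulD : left_distributive mps_mul mps_add.
Proof.
move=> f g h; apply: mpsP => a /=; rewrite -big_split /=.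
by apply: eq_bigr => b _; rewrite mulrDl.
Qed.

Fact mps_one_neq0 : mps_one != 0.
Proof.
apply/eqP => /(congr1 (fun f : mps n K => f 0%MM)) /= /eqP.
by rewrite eqxx oner_eq0.
Qed.

HB.instance Definition _ := GRing.Zmodule_isComNzRing.Build (mps n K)
  mps_mulA mps_mulC mps_mul1 mps_mulD mps_one_neq0.

Definition mps_var (i : 'I_n) : mps n K := MPS (fun a => (a == U_(i)%MM)%:R).

End Ring.

(** Formal substitution f(g_1, ..., g_k). It is meant for series g_i without
    constant term: the coefficient of z^c in g_1^a_1 ... g_k^a_k then vanishes
    as soon as |a| > |c|, so that only |a| <= |c| contributes
    (see [mps_substE]). *)
Definition mps_subst k n (K : comNzRingType) (f : mps k K)
    (g : 'I_k -> mps n K) : mps n K :=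
  MPS (fun c => \sum_(a : 'X_{1..k < (mdeg c).+1})
                  f a * (\prod_(i < k) g i ^+ a i) c).

Section Order.
Variables (n : nat) (K : comNzRingType).

Let vanish d (f : mps n K) := forall c, (mdeg c < d)%N -> f c = 0.

Let vanishM d e f g : vanish d f -> vanish e g -> vanish (d + e) (f * g).
Proof.
move=> fd ge c cde; apply: big1 => -[a b] /= /eqP cab.
case: (ltnP (mdeg a) d) => [/fd->|da]; first by rewrite mul0r.
rewrite ge ?mulr0 // -(ltn_add2l (mdeg a)) -mdegD -cab.
by apply: leq_trans cde _; rewrite leq_add2r.
Qed.

Lemma mps_prod_vanish k (g : 'I_k -> mps n K) (a : 'X_{1..k}) c :
    (forall i, g i 0%MM = 0) -> (mdeg c < mdeg a)%N ->
  (\prod_(i < k) g i ^+ a i) c = 0.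
Proof.
move=> g0; rewrite (mdegE a); move: c; rewrite -/(vanish _ _).
apply: (@big_ind2 _ _ vanish) => [//||i _].
  by move=> d h e h'; apply: vanishM.
elim: (a i) => [|j IHj] //; rewrite exprS -add1n; apply: vanishM IHj => c.
by rewrite ltnS leqn0 mdeg_eq0 => /eqP->.
Qed.

Lemma mps_substE k (f : mps k K) (g : 'I_k -> mps n K) c d :
    (forall i, g i 0%MM = 0) -> (mdeg c < d)%N ->
  mps_subst f g c =
  \sum_(a : 'X_{1..k < d}) f a * (\prod_(i < k) g i ^+ a i) c.
Proof.
move=> g0 cd; rewrite /mps_subst /=; pose F a := f a * (\prod_i g i ^+ a i) c.
rewrite [RHS](bigID (fun a : 'X_{1..k < d} => (mdeg a < (mdeg c).+1)%N)) /=.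
rewrite [X in _ + X]big1 ?addr0 => [|a]; last first.
  by rewrite -leqNgt => ca; rewrite mps_prod_vanish ?mulr0.
pose h (a : 'X_{1..k < (mdeg c).+1}) : 'X_{1..k < d} :=
  BMultinom (leq_trans (bmdeg a) cd).
pose h' (a : 'X_{1..k < d}) : 'X_{1..k < (mdeg c).+1} := insubd bm0 (bmnm a).
rewrite (reindex_onto h h') /=; last first.
  by move=> a ac; apply: val_inj; rewrite /= insubdK.
by apply: eq_bigl => a; rewrite bmdeg /=; apply/esym/eqP/val_inj;
  rewrite insubdK // -topredE /= bmdeg.
Qed.

End Order.

Section Convergence.
Local Open Scope classical_set_scope.
Local Open Scope ereal_scope.

Definition convergent (R : realType) (K : fieldType) (v : K -> R) n
    (f : mps n K) : Prop :=
  exists2 r : R, (0 < r)%R &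
    \esum_(a in [set: 'X_{1..n}]) (v (f a) * r ^+ mdeg a)%:E < +oo.

End Convergence.

(** The concatenated family (u_1, ..., u_n, w_1, ..., w_p). *)
Definition fam_cat T n p (u : 'I_n -> T) (w : 'I_p -> T) (i : 'I_(n + p)) : T :=
  match split i with inl j => u j | inr j => w j end.

(* Main.v *)
Require Import Defs.
From HB Require Import structures.
From mathcomp Require Import all_boot all_order all_algebra.
From mathcomp Require Import mpoly.
From mathcomp Require Import boolp classical_sets cardinality fsbigop.
From mathcomp Require Import reals constructive_ereal ereal esum.
From mathcomp Require finmap.
From mathcomp Require Import ring lra zify.

Set Implicit Arguments.
Unset Strict Implicit.
Unset Printing Implicit Defensive.

Import Order.TTheory GRing.Theory Num.Theory.
Local Open Scope ring_scope.

(** The proof is by induction on the number of variables [x], for all the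
    convergent equations of the formal point at once: a single convergent family
    through [ybar] satisfies every convergent equation that [ybar] satisfies
    ([solvable_vanishing]).

    Among the convergent equations of [ybar], choose [h] of them with a nonzero
    [h]-minor of the Jacobian matrix with respect to [y] at [ybar], [h] being
    maximal. It is enough to parametrize the zeros of this system
    ([solvable_of_system]): if [g] is a further equation, the bordered minors of
    the system and [g] also vanish at [ybar], by maximality of [h], and along a
    parametrized solution [y(x,t)] of the system the derivatives of [g(x,y(x,t))]
    in [t] are combinations of these minors, up to a factor that does not vanish
    at [tbar]. Iterating, all the derivatives in [t] of [g(x,y(x,t))] vanish at
    [t = tbar(x)], hence [g(x,y(x,t)) = 0] in characteristic zero
    ([flat_eq0]).

    For the system itself, a change of coordinates ([regular_coordinates]) makes
    the minor regular in one of the variables at [ybar]. Then [weierstrass_step],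
    following Artin, reduces the construction of a convergent family of
    approximate solutions to one variable less, and [newton_step], after
    Tougeron, corrects this family to exact solutions by the implicit function
    theorem.

    The only analytic ingredient is the Weierstrass division theorem
    ([weierstrass_div]). Its quotient is constructed formally over the given
    field and then bounded by a contraction estimate. The implicit function
    theorem and the Taylor expansion with convergent remainder are consequences
    of the division theorem. *)

(** * Coefficients and truncations *)

Section Coefficients.
Variables (n : nat) (K : fieldType).
Implicit Types (f g : mps n K) (a b : 'X_{1..n}) (p q : {mpoly K[n]}).

Lemma coef0 a : (0 : mps n K) a = 0. Proof. by []. Qed.
Lemma coefD f g a : (f + g) a = f a + g a. Proof. by []. Qed.
Lemma coefN f a : (- f) a = - f a. Proof. by []. Qed.
Lemma coefB f g a : (f - g) a = f a - g a. Proof. by []. Qed.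

Lemma coef_sum I (r : seq I) (P : pred I) (F : I -> mps n K) a :
  (\sum_(i <- r | P i) F i) a = \sum_(i <- r | P i) F i a.
Proof. exact: (big_morph (fun f : mps n K => f a)). Qed.

Lemma coefM d f g a : (mdeg a < d)%N ->
  (f * g) a =
  \sum_(b : 'X_{1..n < d, d} | a == (b.1 + b.2)%MM) f b.1 * g b.2.
Proof.
move=> ad; rewrite [LHS](mps_mulE _ _ ad) (mcoeff_poly_mul _ _ ad).
by apply: eq_bigr => -[b c] _ /=; rewrite !mps_truncE ?bmdeg.
Qed.

(** Polynomials are dense for the topology of agreement in low degrees, so that
    identities between series are proved on polynomials. *)
Definition eqd d f g := forall a, (mdeg a < d)%N -> f a = g a.

Lemma eqdP f g : (forall d, eqd d f g) -> f = g.
Proof. by move=> fg; apply: mpsP => a; apply: (fg (mdeg a).+1). Qed.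

Lemma eqdW d e f g : (d <= e)%N -> eqd e f g -> eqd d f g.
Proof. by move=> de fg a ad; apply: fg; apply: leq_trans ad de. Qed.

Lemma eqdD d f f' g g' : eqd d f f' -> eqd d g g' -> eqd d (f + g) (f' + g').
Proof. by move=> ff gg a ad; rewrite !coefD ff ?gg. Qed.

Lemma eqdM d f f' g g' : eqd d f f' -> eqd d g g' -> eqd d (f * g) (f' * g').
Proof.
move=> ff gg a ad; rewrite !(coefM _ _ (ltnSn (mdeg a))).
apply: eq_bigr => -[b c] _ /=; rewrite ff ?gg //.
  exact: leq_trans (bmdeg c) ad.
exact: leq_trans (bmdeg b) ad.
Qed.

Lemma eqd_sum d I (r : seq I) (P : pred I) (F G : I -> mps n K) :
  (forall i, P i -> eqd d (F i) (G i)) ->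
  eqd d (\sum_(i <- r | P i) F i) (\sum_(i <- r | P i) G i).
Proof.
by move=> FG a ad; rewrite !coef_sum; apply: eq_bigr => i Pi; apply: FG.
Qed.

Definition pol p : mps n K := MPS (fun a => p@_a).

Lemma pol_trunc d f : eqd d (pol (mps_trunc d f)) f.
Proof. by move=> a ad; rewrite /= mps_truncE. Qed.

Fact pol_zmod_morphism : zmod_morphism pol.
Proof. by move=> p q; apply: mpsP => a /=; rewrite mcoeffB. Qed.
Fact pol_monoid_morphism : monoid_morphism pol.
Proof.
split; first by apply: mpsP => a /=; rewrite mcoeff1.
move=> p q; apply: mpsP => a.
rewrite (coefM _ _ (ltnSn (mdeg a))) /=.
by rewrite (mcoeff_poly_mul _ _ (ltnSn (mdeg a))).
Qed.
HB.instance Definition _ := GRing.isZmodMorphism.Build _ _ pol pol_zmod_morphism.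
HB.instance Definition _ :=
  GRing.isMonoidMorphism.Build _ _ pol pol_monoid_morphism.

Lemma polM p q : pol (p * q) = pol p * pol q. Proof. exact: rmorphM. Qed.
Lemma polD p q : pol (p + q) = pol p + pol q. Proof. exact: raddfD. Qed.

Definition mpsC (c : K) : mps n K := pol c%:MP.

Fact mpsC_zmod_morphism : zmod_morphism mpsC.
Proof. by move=> c d; rewrite /mpsC !raddfB. Qed.
Fact mpsC_monoid_morphism : monoid_morphism mpsC.
Proof. by split=> [|c d]; rewrite /mpsC ?mpolyCM !(rmorph1, rmorphM). Qed.
HB.instance Definition _ :=
  GRing.isZmodMorphism.Build _ _ mpsC mpsC_zmod_morphism.
HB.instance Definition _ :=
  GRing.isMonoidMorphism.Build _ _ mpsC mpsC_monoid_morphism.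

Lemma coefC c a : mpsC c a = c *+ (a == 0%MM).
Proof. by rewrite /= mcoeffC mulr_natr. Qed.

Lemma coefCM c f a : (mpsC c * f) a = c * f a.
Proof.
pose d := (mdeg a).+1.
have /(_ a (ltnSn _)) -> : eqd d (mpsC c * f) (mpsC c * pol (mps_trunc d f)).
  by apply: eqdM => // b bd; rewrite pol_trunc.
by rewrite /mpsC -rmorphM /= mul_mpolyC mcoeffZ mps_truncE.
Qed.

Lemma pol_X i : pol 'X_i = mps_var K i.
Proof. by apply: mpsP => a /=; rewrite mcoeffX eq_sym. Qed.

Definition cst f : K := f 0%MM.

Fact cst_zmod_morphism : zmod_morphism cst. Proof. by []. Qed.
Fact cst_monoid_morphism : monoid_morphism cst.
Proof.
split=> [|f g]; rewrite /cst; first by rewrite /= eqxx.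
rewrite (@coefM 1) ?mdeg0 // (bigD1 (bm0, bm0)) /= ?addm0 // big1 ?addr0 //.
case=> b c /= /andP[]; rewrite eq_sym mnmD_eq0 => /andP[/eqP b0 /eqP c0].
by case/eqP; congr pair; apply: val_inj; rewrite /= ?b0 ?c0.
Qed.
HB.instance Definition _ := GRing.isZmodMorphism.Build _ _ cst cst_zmod_morphism.
HB.instance Definition _ :=
  GRing.isMonoidMorphism.Build _ _ cst cst_monoid_morphism.

Lemma cstC c : cst (mpsC c) = c.
Proof. by rewrite /cst coefC eqxx. Qed.

Lemma cst_var i : cst (mps_var K i) = 0.
Proof. by rewrite /cst /= eq_sym mnm1_eq0. Qed.

Lemma mps_min f : f != 0 ->
  exists2 a, f a != 0 & forall b, (b < a)%O -> f b = 0.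
Proof.
move=> f0; have [a fa] : exists a, f a != 0.
  apply: contrapT => /forallNP f0'; case/eqP: f0; apply: mpsP => a.
  by apply/eqP/negPn/negP/f0'.
elim/(well_founded_ind (@ltom_wf n)): a fa => a IH fa.
have [|/forallNP H] := pselect (exists b, (b < a)%O /\ f b != 0).
  by case=> b [ba fb]; apply: IH ba fb.
exists a => // b ba; apply/eqP/negPn/negP => fb; exact: (H b (conj ba fb)).
Qed.

(** The least monomials of two nonzero series, for the degree-lexicographic
    order, multiply to the least monomial of the product. *)
Lemma mps_mul_eq0 f g : f * g = 0 -> f = 0 \/ g = 0.
Proof.
move=> fg; case: (eqVneq f 0) => [->|f0]; first by left.
right; apply: contrapT => /eqP g0.
have [a fa amin] := mps_min f0; have [b gb bmin] := mps_min g0.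
have := congr1 (fun h : mps n K => h (a + b)%MM) fg.
rewrite (coefM _ _ (ltnSn _)) /=.
have ha : (mdeg a < (mdeg (a + b)%MM).+1)%N by rewrite ltnS mdegD leq_addr.
have hb : (mdeg b < (mdeg (a + b)%MM).+1)%N by rewrite ltnS mdegD leq_addl.
rewrite (bigD1 (BMultinom ha, BMultinom hb)) //= big1 ?addr0; last first.
  case=> c d /= /andP[/eqP cd ne].
  case: (ltP (bmnm c) a) => [/amin->|ac]; first by rewrite mul0r.
  case: (ltP (bmnm d) b) => [/bmin->|bd]; first by rewrite mulr0.
  case/eqP: ne; congr pair; apply: val_inj => /=.
    apply: le_anti; rewrite ac andbT leNgt; apply/negP => ac'.
    by have := ltmc_le_add ac' bd; rewrite -cd ltxx.
  apply: le_anti; rewrite bd andbT leNgt; apply/negP => bd'.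
  by have := lemc_lt_add ac bd'; rewrite -cd ltxx.
by move/eqP; rewrite mulf_eq0 (negPf fa) (negPf gb).
Qed.

Lemma mps_mul_neq0 f g : f != 0 -> g != 0 -> f * g != 0.
Proof. by move=> f0 g0; apply/eqP => /mps_mul_eq0 [] /eqP; apply/negP. Qed.

Lemma mps_mulI f g h : f != 0 -> f * g = f * h -> g = h.
Proof.
move=> f0 /eqP; rewrite -subr_eq0 -mulrBr => /eqP /mps_mul_eq0 [/eqP|].
  by rewrite (negPf f0).
by move/eqP; rewrite subr_eq0 => /eqP.
Qed.

End Coefficients.
Arguments mpsC n {K} c : simpl never.
Arguments pol {n K} p : simpl never.
Arguments cst {n K} f : simpl never.

(** * Formal substitution *)

Lemma mpoly_ring_ind n (K : fieldType) (P : {mpoly K[n]} -> Prop) :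
  (forall c, P c%:MP) -> (forall i, P 'X_i) ->
  (forall p q, P p -> P q -> P (p + q)) ->
  (forall p q, P p -> P q -> P (p * q)) -> forall p, P p.
Proof.
move=> PC PX PD PM p; rewrite (mpolyE p).
apply: big_ind => [|//|a _]; first by rewrite -[0](mpolyC0 n).
rewrite -mul_mpolyC; apply: (PM) => //.
rewrite mpolyXE_id; apply: big_ind => [|//|i _].
  by rewrite -[1](mpolyC1 n).
elim: (a i) => [|k IHk]; first by rewrite expr0 -[1](mpolyC1 n).
by rewrite exprS; apply: (PM).
Qed.

Section Evaluation.
Variables (k n : nat) (K : fieldType).
Implicit Types (g : 'I_k -> mps n K) (f : mps k K) (p : {mpoly K[k]}).

Let center g i := g i - mpsC n (cst (g i)).

Let center0 g i : center g i 0%MM = 0.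
Proof. by rewrite /center coefB coefC eqxx subrr. Qed.

(** Removing the constant terms of the family before the substitution makes
    [ev g] a ring morphism for every family [g], so that the composition and
    chain rules below need no side condition; only the value at a variable
    does. *)
Definition ev g f : mps n K := mps_subst f (center g).

Lemma evE g f : (forall i, cst (g i) = 0) -> ev g f = mps_subst f g.
Proof.
move=> g0; rewrite /ev; congr mps_subst; apply: funext => i.
by rewrite /center g0 rmorph0 subr0.
Qed.

Lemma ev_eqd d g f f' : eqd d f f' -> eqd d (ev g f) (ev g f').
Proof.
move=> ff c cd /=; apply: eq_bigr => a _; rewrite ff //.
exact: leq_trans (bmdeg a) cd.
Qed.

Lemma ev_pol g p : ev g (pol p) = mmap (mpsC n) (center g) p.
Proof.
apply: mpsP => c; pose d := maxn (msize p) (mdeg c).+1.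
rewrite /ev (@mps_substE _ _ _ _ _ _ d) ?leq_maxr //.
rewrite (@mmapE _ _ _ _ _ p d) ?leq_maxl // coef_sum.
by apply: eq_bigr => a _; rewrite coefCM.
Qed.

Fact ev_zmod_morphism g : zmod_morphism (ev g).
Proof.
move=> f f'; apply: mpsP => c /=; rewrite -sumrB.
by apply: eq_bigr => a _; rewrite mulrBl.
Qed.

Fact ev_monoid_morphism g : monoid_morphism (ev g).
Proof.
split=> [|f f'].
  have -> : 1 = pol 1 :> mps k K by rewrite rmorph1.
  by rewrite ev_pol rmorph1.
apply: eqdP => d; pose F := mps_trunc d f; pose F' := mps_trunc d f'.
have H : eqd d (f * f') (pol (F * F')).
  by rewrite rmorphM; apply: eqdM => a ad; rewrite pol_trunc.
have HM : ev g (pol (F * F')) = ev g (pol F) * ev g (pol F').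
  by rewrite !ev_pol rmorphM.
move=> a ad; rewrite (ev_eqd g H) // HM.
by apply: eqdM ad; apply: ev_eqd; apply: pol_trunc.
Qed.
HB.instance Definition _ g :=
  GRing.isZmodMorphism.Build _ _ (ev g) (ev_zmod_morphism g).
HB.instance Definition _ g :=
  GRing.isMonoidMorphism.Build _ _ (ev g) (ev_monoid_morphism g).

Lemma evC g c : ev g (mpsC k c) = mpsC n c.
Proof. by rewrite /mpsC ev_pol mmapC. Qed.

Lemma ev_var_gen g i : ev g (mps_var K i) = g i - mpsC n (cst (g i)).
Proof. by rewrite -pol_X ev_pol mmapX mmap1U. Qed.

Lemma ev_var g i : cst (g i) = 0 -> ev g (mps_var K i) = g i.
Proof. by move=> gi; rewrite ev_var_gen gi rmorph0 subr0. Qed.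

Lemma cst_ev g f : cst (ev g f) = cst f.
Proof.
rewrite /cst /ev /mps_subst /= (big_pred1 bm0) => [|a]; last first.
  apply/esym/eqP/val_inj/eqP; rewrite /= -mdeg_eq0.
  by have := bmdeg a; move: (bmnm a) => b; rewrite mdeg0 ltnS leqn0.
by rewrite /= big1 ?mulr1 /= ?eqxx ?mulr1 // => i _; rewrite mnm0E expr0.
Qed.

(** The loss of [e] degrees leaves room for derivatives. *)
Lemma eq_ev_ext (Phi Psi : mps k K -> mps n K) e :
    (forall d f f', eqd (d + e) f f' -> eqd d (Phi f) (Phi f')) ->
    (forall d f f', eqd (d + e) f f' -> eqd d (Psi f) (Psi f')) ->
    (forall p, Phi (pol p) = Psi (pol p)) ->
  forall f, Phi f = Psi f.
Proof.
move=> Phic Psic PP f; apply: eqdP => d a ad.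
have /Phic/(_ a ad) <- := @pol_trunc _ _ (d + e) f.
by have /Psic/(_ a ad) <- := @pol_trunc _ _ (d + e) f; rewrite PP.
Qed.

End Evaluation.
Arguments ev {k n K} g f : simpl never.

Lemma ev_ev k n q (K : fieldType) (h : 'I_n -> mps q K) (g : 'I_k -> mps n K)
    (f : mps k K) : ev h (ev g f) = ev (fun i => ev h (g i)) f.
Proof.
move: f; apply: (@eq_ev_ext _ _ _ _ _ 0).
- by move=> d f f'; rewrite addn0 => H; do 2! apply: ev_eqd.
- by move=> d f f'; rewrite addn0 => H; apply: ev_eqd.
elim/mpoly_ring_ind => [c|i|p p' IH IH'|p p' IH IH'].
- by rewrite !evC.
- by rewrite pol_X !ev_var_gen rmorphB /= evC cst_ev.
- by rewrite !rmorphD /= IH IH'.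
- by rewrite !rmorphM /= IH IH'.
Qed.

Lemma ev_id k (K : fieldType) (f : mps k K) : ev (@mps_var k K) f = f.
Proof.
move: f; apply: (@eq_ev_ext _ _ _ _ _ 0) => //.
- by move=> d f f'; rewrite addn0 => H; apply: ev_eqd.
- by move=> d f f'; rewrite addn0.
elim/mpoly_ring_ind => [c|i|p p' IH IH'|p p' IH IH'].
- by rewrite evC.
- by rewrite pol_X ev_var ?cst_var.
- by rewrite !rmorphD /= IH IH'.
- by rewrite !rmorphM /= IH IH'.
Qed.

Lemma eq_ev k n (K : fieldType) (g h : 'I_k -> mps n K) (f : mps k K) :
  g =1 h -> ev g f = ev h f.
Proof. by move=> /funext ->. Qed.

(** * Partial derivatives *)

Section Derivation.
Variables (n : nat) (K : fieldType) (i : 'I_n).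
Implicit Types (f g : mps n K) (p : {mpoly K[n]}).

Definition deriv f : mps n K := MPS (fun a => f (a + U_(i))%MM *+ (a i).+1).

Lemma deriv_pol p : deriv (pol p) = pol (mderiv i p).
Proof. by apply: mpsP => a; rewrite /= mcoeff_deriv. Qed.

Lemma deriv_eqd d f g : eqd (d + 1) f g -> eqd d (deriv f) (deriv g).
Proof. by move=> fg a ad /=; rewrite fg // mdegD mdeg1 ltn_add2r. Qed.

Fact deriv_zmod_morphism : zmod_morphism deriv.
Proof. by move=> f g; apply: mpsP => a /=; rewrite mulrnBl. Qed.
HB.instance Definition _ :=
  GRing.isZmodMorphism.Build _ _ deriv deriv_zmod_morphism.

Lemma derivM f g : deriv (f * g) = deriv f * g + f * deriv g.
Proof.
apply: eqdP => d; pose F := mps_trunc (d + 1) f; pose G := mps_trunc (d + 1) g.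
have eF : eqd (d + 1) (pol F) f := pol_trunc f.
have eG : eqd (d + 1) (pol G) g := pol_trunc g.
have dd : (d <= d + 1)%N by rewrite leq_addr.
move=> a ad; have := deriv_eqd (eqdM eF eG) ad => <-.
rewrite -polM deriv_pol mderivM polD !polM -!deriv_pol.
apply: eqdD ad; apply: eqdM; by [exact: deriv_eqd | exact: eqdW dd _].
Qed.

Lemma derivC c : deriv (mpsC n c) = 0.
Proof. by rewrite /mpsC deriv_pol mderivC rmorph0. Qed.

Lemma deriv_var j : deriv (mps_var K j) = (i == j)%:R.
Proof.
rewrite -pol_X deriv_pol mderivX mnm1E eq_sym -mul_mpolyC rmorphM /=.
case: eqP => [->|_]; rewrite ?rmorph0 ?mul0r //.
by rewrite -{1}[U_(j)%MM]add0m addmK mpolyX0 !rmorph1 mulr1.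
Qed.

Lemma cst_deriv f : cst (deriv f) = f U_(i)%MM.
Proof. by rewrite /cst /= add0m mnm0E. Qed.

End Derivation.
Arguments deriv {n K} i f : simpl never.

Lemma deriv_ev k n (K : fieldType) (l : 'I_n) (g : 'I_k -> mps n K)
    (f : mps k K) :
  deriv l (ev g f) = \sum_j ev g (deriv j f) * deriv l (g j).
Proof.
move: f; apply: (@eq_ev_ext _ _ _ _ _ 1).
- by move=> d f f' H; apply: deriv_eqd; apply: ev_eqd.
- move=> d f f' H; apply: eqd_sum => j _; apply: eqdM => //.
  by apply: ev_eqd; apply: deriv_eqd.
elim/mpoly_ring_ind => [c|i|p p' IH IH'|p p' IH IH'].
- rewrite evC derivC big1 // => j _.
  by rewrite -/(mpsC k c) derivC rmorph0 mul0r.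
- rewrite pol_X ev_var_gen raddfB /= derivC subr0 (bigD1 i) //= big1 => [|j ji].
    by rewrite deriv_var eqxx rmorph1 mul1r addr0.
  by rewrite deriv_var (negPf ji) rmorph0 mul0r.
- rewrite polD !raddfD /= IH IH' -big_split /=; apply: eq_bigr => j _.
  by rewrite raddfD raddfD /= mulrDl.
- rewrite polM rmorphM derivM IH IH' mulr_suml mulr_sumr -big_split /=.
  apply: eq_bigr => j _; rewrite derivM rmorphD !rmorphM /= mulrDl.
  by rewrite mulrAC mulrA.
Qed.

(** * Finite sums of nonnegative numbers *)

Section FiniteSums.
Variable R : realType.

Lemma ler_sum_inj (A B : finType) (h : A -> B) (P : pred A) (F : B -> R) :
  injective h -> (forall b, 0 <= F b) ->
  \sum_(a | P a) F (h a) <= \sum_b F b.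
Proof.
move=> h_inj F0; have -> : \sum_(a | P a) F (h a) = \sum_(b in h @: P) F b.
  by rewrite big_imset //= => x y _ _; apply: h_inj.
by rewrite [leRHS](bigID (mem (h @: P))) /= lerDl sumr_ge0.
Qed.

Lemma ler_sum_cond (A : finType) (P : pred A) (F : A -> R) :
  (forall a, 0 <= F a) -> \sum_(a | P a) F a <= \sum_a F a.
Proof. exact: (@ler_sum_inj A A id). Qed.

Lemma sum_at_most_one (A : finType) (P : pred A) (x : R) : 0 <= x ->
  (forall a b, P a -> P b -> a = b) -> \sum_(a | P a) x <= x.
Proof.
move=> x0 P1; have [a Pa|P0] := pickP P; last by rewrite big_pred0.
by rewrite (big_pred1 a) // => b /=; apply/idP/eqP => [Pb|->]; [apply: P1|].
Qed.

Lemma exists_small_radius (I : finType) (P : I -> R -> Prop) :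
    (forall i, exists2 e : R, 0 < e & forall r, 0 < r -> r <= e -> P i r) ->
  exists2 r : R, 0 < r & forall i, P i r.
Proof.
move=> H; have [i|e He] := @choice _ _ (fun i e => 0 < e /\
    forall r, 0 < r -> r <= e -> P i r).
  by have [e e0 eP] := H i; exists e.
have r0 : 0 < \big[Num.min/1]_i e i.
  apply: (big_ind (fun x : R => 0 < x)) => [|x y x0 y0|i _] //.
    by rewrite lt_min x0 y0.
  by have [] := He i.
exists (\big[Num.min/1]_i e i) => // i; have [_] := He i; apply => //.
exact: bigmin_le_cond.
Qed.

End FiniteSums.

(** * Absolute values and truncated sum norms *)

Section AbsoluteValue.
Variables (R : realType) (K : fieldType) (v : K -> R).
Hypothesis av : absolute_value v.

Lemma av_ge0 a : 0 <= v a. Proof. exact: (absv_ge0 av). Qed.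
Lemma avM a b : v (a * b) = v a * v b. Proof. exact: (absvM av). Qed.
Lemma avD a b : v (a + b) <= v a + v b. Proof. exact: (absvD av). Qed.
Lemma av0 : v 0 = 0. Proof. by apply/(absv_eq0 av). Qed.
Lemma av_neq0 a : a != 0 -> v a != 0.
Proof. by apply: contraNneq => /(absv_eq0 av) ->. Qed.
Lemma av_gt0 a : a != 0 -> 0 < v a.
Proof. by move=> /av_neq0 va; rewrite lt0r va av_ge0. Qed.
Lemma av1 : v 1 = 1.
Proof.
have /mulfI : v 1 != 0 by rewrite av_neq0 ?oner_eq0.
by apply; rewrite -avM !mulr1.
Qed.
Lemma avN a : v (- a) = v a.
Proof.
suff vN1 : v (-1) = 1 by rewrite -mulN1r avM vN1 mul1r.
have : v (-1) ^+ 2 = 1 by rewrite expr2 -avM mulrNN mulr1 av1.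
by move/eqP; rewrite pexpr_eq1 ?av_ge0 // => /eqP.
Qed.
Lemma avB a b : v (a - b) <= v a + v b.
Proof. by rewrite -(avN b) avD. Qed.
Lemma av_sum I (r : seq I) (P : pred I) (F : I -> K) :
  v (\sum_(i <- r | P i) F i) <= \sum_(i <- r | P i) v (F i).
Proof.
apply: (big_ind2 (fun x y => v x <= y)) => // [|x x' y y' xx yy].
  by rewrite av0.
by apply: le_trans (avD _ _) _; apply: lerD.
Qed.
Lemma avMn a k : v (a *+ k) <= v a *+ k.
Proof.
elim: k => [|k IH]; first by rewrite !mulr0n av0.
by rewrite !mulrS; apply: le_trans (avD _ _) _; rewrite lerD2l.
Qed.

Section Norm.
Variable n : nat.
Implicit Types (f g : mps n K) (a b : 'X_{1..n}) (r : R).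

Definition nrm r d f : R := \sum_(a : 'X_{1..n < d}) v (f a) * r ^+ mdeg a.

Let term_ge0 r f a : 0 <= r -> 0 <= v (f a) * r ^+ mdeg a.
Proof. by move=> r0; rewrite mulr_ge0 ?av_ge0 ?exprn_ge0. Qed.

Lemma nrm_ge0 r d f : 0 <= r -> 0 <= nrm r d f.
Proof. by move=> r0; apply: sumr_ge0 => a _; apply: term_ge0. Qed.

Lemma nrm_eqd r d f g : eqd d f g -> nrm r d f = nrm r d g.
Proof. by move=> fg; apply: eq_bigr => a _; rewrite fg ?bmdeg. Qed.

Lemma nrm_le r r' d f : 0 <= r -> r <= r' -> nrm r d f <= nrm r' d f.
Proof.
move=> r0 rr; apply: ler_sum => a _; rewrite ler_wpM2l ?av_ge0 //.
by rewrite lerXn2r ?nnegrE // (le_trans r0).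
Qed.

Lemma nrmD r d f g : 0 <= r -> nrm r d (f + g) <= nrm r d f + nrm r d g.
Proof.
move=> r0; rewrite -big_split; apply: ler_sum => a _ /=.
by rewrite -mulrDl ler_wpM2r ?exprn_ge0 // avD.
Qed.

Lemma nrmN r d f : nrm r d (- f) = nrm r d f.
Proof. by apply: eq_bigr => a _; rewrite coefN avN. Qed.

Lemma nrmC r d c : nrm r d (mpsC n c) <= v c.
Proof.
rewrite /nrm; apply: le_trans (_ : \sum_(a : 'X_{1..n < d} | bmnm a == 0%MM) v c <= _).
  rewrite (bigID (fun a : 'X_{1..n < d} => bmnm a == 0%MM)) /=.
  rewrite [X in _ + X]big1 ?addr0 => [|a a0]; last first.
    by rewrite mcoeffC (negPf a0) mulr0 av0 mul0r.
  by apply: ler_sum => a /eqP ->; rewrite mcoeffC eqxx mulr1 mdeg0 expr0 mulr1.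
apply: sum_at_most_one; first exact: av_ge0.
by move=> a b /eqP a0 /eqP b0; apply: val_inj; rewrite /= a0 b0.
Qed.

Lemma nrm_var r d i : 0 <= r -> nrm r d (mps_var K i) <= r.
Proof.
move=> r0; rewrite /nrm.
apply: le_trans (_ : \sum_(a : 'X_{1..n < d} | bmnm a == U_(i)%MM) r <= _).
  rewrite (bigID (fun a : 'X_{1..n < d} => bmnm a == U_(i)%MM)) /=.
  rewrite [X in _ + X]big1 ?addr0 => [|a a0]; last first.
    by rewrite (negPf a0) av0 mul0r.
  by apply: ler_sum => a /eqP ->; rewrite eqxx av1 mdeg1 expr1 mul1r.
apply: sum_at_most_one => //.
by move=> a b /eqP a0 /eqP b0; apply: val_inj; rewrite /= a0 b0.
Qed.

Lemma nrm_sum r d I (s : seq I) (P : pred I) (F : I -> mps n K) : 0 <= r ->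
  nrm r d (\sum_(i <- s | P i) F i) <= \sum_(i <- s | P i) nrm r d (F i).
Proof.
move=> r0; apply: (big_ind2 (fun x y => nrm r d x <= y)) => // [|x x' y y' xx yy].
  by rewrite /nrm big1 // => a _; rewrite coef0 av0 mul0r.
by apply: le_trans (nrmD _ _ _ r0) _; apply: lerD.
Qed.

Lemma nrmM r d f g : 0 <= r -> nrm r d (f * g) <= nrm r d f * nrm r d g.
Proof.
move=> r0; pose F a := v (f a) * r ^+ mdeg a; pose G a := v (g a) * r ^+ mdeg a.
have F0 a : 0 <= F a by apply: term_ge0.
have G0 a : 0 <= G a by apply: term_ge0.
pose p (b : 'X_{1..n < d, d}) := (b.1 + b.2)%MM.
apply: (@le_trans _ _ (\sum_(a : 'X_{1..n < d})
    \sum_(b : 'X_{1..n < d, d} | bmnm a == p b) F b.1 * G b.2)).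
  apply: ler_sum => a _; rewrite (coefM _ _ (bmdeg a)).
  apply: le_trans (ler_wpM2r _ (av_sum _ _ _)) _; first exact: exprn_ge0.
  rewrite mulr_suml; apply: ler_sum => b /eqP ab.
  by rewrite avM ab mdegD exprD mulrACA.
rewrite (exchange_big_dep predT) //= /nrm -/F -/G big_distrlr /= pair_big /=.
apply: ler_sum => b _; apply: sum_at_most_one; first by rewrite mulr_ge0.
by move=> a a' /eqP ab /eqP ab'; apply: val_inj; rewrite /= ab ab'.
Qed.

Lemma nrm_prod r d I (s : seq I) (P : pred I) (F : I -> mps n K) : 0 <= r ->
  nrm r d (\prod_(i <- s | P i) F i) <= \prod_(i <- s | P i) nrm r d (F i).
Proof.
move=> r0; suff [] : 0 <= nrm r d (\prod_(i <- s | P i) F i)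
   /\ nrm r d (\prod_(i <- s | P i) F i) <= \prod_(i <- s | P i) nrm r d (F i).
  by [].
apply: (big_ind2 (fun x y => 0 <= nrm r d x /\ nrm r d x <= y)) => //.
- split; first exact: nrm_ge0.
  by have := nrmC r d 1; rewrite rmorph1 av1.
- move=> x x' y y' [x0 xx] [y0 yy]; split; first exact: nrm_ge0.
  by apply: le_trans (nrmM _ _ _ r0) _; apply: ler_pM.
- by move=> i _; split => //; apply: nrm_ge0.
Qed.

Lemma nrmX r d f k : 0 <= r -> nrm r d (f ^+ k) <= nrm r d f ^+ k.
Proof.
move=> r0; have := nrm_prod d (index_iota 0 k) predT (fun=> f) r0.
by rewrite !big_const_nat !iter_mulr !mulr1 !subn0.
Qed.

(** Only monomials of positive degree contribute, so that shrinking the radius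
    makes the norm as small as needed for a substitution to converge. *)
Lemma nrm_shrink r r' d f : cst f = 0 -> 0 < r -> r <= r' ->
  nrm r d f <= r / r' * nrm r' d f.
Proof.
move=> f0 r0 rr; have r'0 : 0 < r' := lt_le_trans r0 rr.
rewrite /nrm mulr_sumr; apply: ler_sum => a _.
have [a0|a0] := eqVneq (bmnm a) 0%MM.
  by rewrite a0 -[f 0%MM]/(cst f) f0 av0 !mul0r mulr0.
rewrite mulrCA ler_wpM2l ?av_ge0 //.
have -> : r ^+ mdeg a = (r / r') ^+ mdeg a * r' ^+ mdeg a.
  by rewrite -exprMn divfK ?gt_eqF.
apply: ler_wpM2r; first by rewrite exprn_ge0 ?ltW.
move: a0; rewrite -mdeg_eq0; case: (mdeg a) => // k _.
have q0 : 0 <= r / r' by rewrite divr_ge0 // ltW.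
have q1 : r / r' <= 1 by rewrite ler_pdivrMr ?mul1r.
rewrite exprS; apply: ler_piMr => //; exact: exprn_ile1.
Qed.

(** Convergence in terms of finite sums only, to which the estimates for
    products, substitutions and quotients apply. *)
Definition conv_bound f := exists2 r : R, 0 < r &
  exists C : R, forall d, nrm r d f <= C.

Lemma nrm_sub_seq r f (s : seq 'X_{1..n}) : 0 <= r -> uniq s ->
  exists d, \sum_(a <- s) v (f a) * r ^+ mdeg a <= nrm r d f.
Proof.
move=> r0 us; pose d := (\max_(a <- s) (mdeg a).+1)%N; exists d.
have sd a : a \in s -> (mdeg a < d)%N.
  by move=> sa; rewrite /d (bigD1_seq a) //= leq_maxl.
pose s' : seq 'X_{1..n < d} := pmap insub s.
have ss' : map val s' = s.
  rewrite /s' (pmap_filter (@insubK _ _ _)); apply/all_filterP/allP => a sa.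
  by rewrite /= isSome_insub; apply: sd.
rewrite -{1}ss' big_map big_uniq /=; last by rewrite -(map_inj_uniq val_inj) ss'.
by apply: ler_sum_cond => a; apply: term_ge0.
Qed.

Lemma convergentP f : convergent v f <-> conv_bound f.
Proof.
split=> [[r r0 fin]|[r r0 [C bC]]].
  exists r => //; exists (fine (\esum_(a in [set: 'X_{1..n}])
     (v (f a) * r ^+ mdeg a)%:E)) => d.
  have tge0 a : (0 <= (v (f a) * r ^+ mdeg a)%:E)%E.
    by rewrite lee_fin term_ge0 // ltW.
  have finE : \esum_(a in [set: 'X_{1..n}]) (v (f a) * r ^+ mdeg a)%:E
      \is a fin_num by rewrite ge0_fin_numE // esum_ge0.
  rewrite -lee_fin fineK //.
  apply: esum_ge; exists [set` map (@bmnm n d) (enum {: 'X_{1..n < d}})]%classic.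
    by split => [|? _]; [exact: finite_seq|].
  rewrite -fsbig_seq; last by rewrite map_inj_uniq ?enum_uniq //; exact: val_inj.
  by rewrite big_map big_enum /= -sumEFin.
exists r => //; apply: (@le_lt_trans _ _ C%:E); last exact: ltry.
apply: ge_ereal_sup => _ [A [finA _] <-].
rewrite fsbig_finite //= sumEFin lee_fin.
have [d] := nrm_sub_seq f (ltW r0) (finmap.fset_uniq (fset_set A)).
by move=> /le_trans; apply.
Qed.

End Norm.

End AbsoluteValue.

(** * The ring of convergent series *)

Section ConvergentSeries.
Variables (R : realType) (K : fieldType) (v : K -> R).
Variable av : absolute_value v.

(** The axioms [av] are an argument, so that the closure properties below can be
    attached to the predicate as canonical structures. *)
Definition cvps n : {pred mps n K} := let _ := av in fun f => `[< convergent v f >].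
Arguments cvps {n}.

Lemma cvpsP n (f : mps n K) : reflect (convergent v f) (f \in cvps).
Proof. exact: asboolP. Qed.

Lemma cvps_bound n (f : mps n K) : f \in cvps ->
  exists r0 C : R, [/\ 0 < r0, 0 <= C &
    forall r d, 0 < r -> r <= r0 -> nrm v r d f <= C].
Proof.
move=> /cvpsP/(convergentP av) [r r0 [C HC]]; exists r, C; split => //.
  by apply: le_trans (HC 0%N); apply: nrm_ge0 (ltW _).
by move=> r' d r'0 r'r; apply: le_trans (HC d); apply: nrm_le => //; apply: ltW.
Qed.

Lemma bound_cvps n (f : mps n K) r C :
  0 < r -> (forall d, nrm v r d f <= C) -> f \in cvps.
Proof. by move=> r0 HC; apply/cvpsP/(convergentP av); exists r => //; exists C. Qed.

Lemma cvps_bound2 n (f g : mps n K) : f \in cvps -> g \in cvps ->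
  exists r C : R, [/\ 0 < r, 0 <= C & forall d, nrm v r d f <= C /\ nrm v r d g <= C].
Proof.
move=> /cvps_bound [r [C [r0 C0 HC]]] /cvps_bound [r' [C' [r'0 C'0 HC']]].
exists (Num.min r r'), (Num.max C C'); split.
- by rewrite lt_min r0.
- by rewrite le_max C0.
move=> d; split; [apply: le_trans (HC _ d _ _) _ | apply: le_trans (HC' _ d _ _) _];
  by rewrite ?lt_min ?r0 ?r'0 // ?ge_min ?le_max ?lexx ?orbT.
Qed.

Fact cvps_subring n : subring_closed (@cvps n).
Proof.
split.
- apply: (@bound_cvps _ _ 1 1) => // d.
  by have := nrmC av n 1 d 1; rewrite rmorph1 av1.
- move=> f g /cvps_bound2 H /H{H} [r [C [r0 C0 HC]]].
  apply: (@bound_cvps _ _ r (C + C)) => // d; have [Hf Hg] := HC d.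
  apply: le_trans (nrmD av _ _ _ (ltW r0)) _; apply: lerD => //.
  by rewrite nrmN.
- move=> f g /cvps_bound2 H /H{H} [r [C [r0 C0 HC]]].
  apply: (@bound_cvps _ _ r (C * C)) => // d; have [Hf Hg] := HC d.
  apply: le_trans (nrmM av _ _ _ (ltW r0)) _.
  by apply: ler_pM => //; apply: nrm_ge0 (ltW r0).
Qed.
HB.instance Definition _ n :=
  GRing.isSubringClosed.Build (mps n K) (@cvps n) (cvps_subring n).

Lemma cvpsC n c : mpsC n c \in cvps.
Proof. by apply: (@bound_cvps _ _ 1 (v c)) => // d; apply: nrmC. Qed.

Lemma cvps_var n i : mps_var K i \in @cvps n.
Proof. by apply: (@bound_cvps _ _ 1 1) => // d; apply: nrm_var. Qed.

(** At a small radius the norms of the centered inner series are below a radius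
    of convergence of the outer series. *)
Lemma cvps_ev k n (g : 'I_k -> mps n K) f :
  f \in cvps -> (forall i, g i \in cvps) -> ev g f \in cvps.
Proof.
move=> /cvps_bound [r' [C [r'0 C0 HC]]] gcv.
pose h i := g i - mpsC n (cst (g i)).
have h0 i : cst (h i) = 0 by rewrite rmorphB /= cstC subrr.
have [i|r r0 Hr] := @exists_small_radius R 'I_k
    (fun i r => forall d, nrm v r d (h i) <= r').
  have /cvps_bound [ri [Ci [ri0 Ci0 HCi]]] : h i \in cvps.
    by rewrite rpredB ?gcv ?cvpsC.
  have Ci1 : 0 < Ci + 1 by rewrite ltr_wpDl.
  exists (Num.min ri (ri * r' / (Ci + 1))).
    by rewrite lt_min ri0 divr_gt0 // mulr_gt0.
  move=> r r0; rewrite le_min => /andP[rri rr] d.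
  apply: le_trans (nrm_shrink av d (h0 i) r0 rri) _.
  apply: le_trans (ler_wpM2l _ (HCi ri d ri0 (lexx _))) _.
    by rewrite divr_ge0 // ltW.
  have rC : r * (Ci + 1) <= ri * r' by rewrite -ler_pdivlMr.
  rewrite mulrAC ler_pdivrMr // [leRHS]mulrC; apply: le_trans rC.
  by rewrite ler_wpM2l ?ltW // ltrDl.
apply: (@bound_cvps _ _ r C) => // d.
have hr i : 0 <= nrm v r d (h i) by apply: nrm_ge0 (ltW r0).
rewrite (@nrm_eqd _ _ v _ r d _
  (\sum_(a : 'X_{1..k < d}) mpsC n (f a) * \prod_i h i ^+ a i)); last first.
  move=> c cd; rewrite /ev (@mps_substE _ _ _ _ _ _ d) // coef_sum.
  by apply: eq_bigr => a _; rewrite coefCM.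
apply: le_trans (nrm_sum av _ _ _ _ (ltW r0)) _.
apply: le_trans (HC r' d r'0 (lexx _)); apply: ler_sum => a _.
apply: le_trans (nrmM av _ _ _ (ltW r0)) _.
apply: ler_pM; rewrite ?nrmC //; try exact: nrm_ge0 (ltW r0).
apply: le_trans (nrm_prod av _ _ _ _ (ltW r0)) _.
rewrite mdegE expr_sum; apply: ler_prod => i _; rewrite nrm_ge0 ?(ltW r0) //=.
apply: le_trans (nrmX av _ _ _ (ltW r0)) _.
by rewrite lerXn2r ?nnegrE ?hr // ltW.
Qed.

Lemma cvps_deriv n i (f : mps n K) : f \in cvps -> deriv i f \in cvps.
Proof.
move=> /cvps_bound [r [C [r0 C0 HC]]].
apply: (@bound_cvps _ _ (r / 2) (C / r)) => [|d]; first by rewrite divr_gt0.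
apply: le_trans (_ : nrm v r (d + 1) f / r <= _); last first.
  by rewrite ler_wpM2r ?invr_ge0 ?(ltW r0) //; apply: HC.
have hlt (a : 'X_{1..n < d}) : (mdeg (a + U_(i))%MM < d + 1)%N.
  by rewrite mdegD mdeg1 ltn_add2r bmdeg.
pose h a : 'X_{1..n < d + 1} := BMultinom (hlt a).
have h_inj : injective h.
  by move=> a b /(congr1 (@bmnm _ _)) /= /addIm ab; apply: val_inj.
have F0 (a : 'X_{1..n < d + 1}) : 0 <= v (f a) * r ^+ mdeg a.
  by rewrite mulr_ge0 ?(av_ge0 av) ?exprn_ge0 ?(ltW r0).
rewrite ler_pdivlMr //; apply: le_trans (ler_sum_inj predT h_inj F0).
rewrite mulr_suml; apply: ler_sum => a _ /=; rewrite mdegD mdeg1 addn1 exprSr.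
rewrite mulrA; apply: ler_wpM2r; first exact: ltW.
apply: le_trans (ler_wpM2r _ (avMn av _ _)) _.
  by rewrite exprn_ge0 // divr_ge0 // ltW.
rewrite expr_div_n mulrnAl -mulrnAr; apply: ler_wpM2l (av_ge0 av _) _ _ _.
rewrite -mulr_natr mulrAC ler_pdivrMr ?exprn_gt0 // ler_wpM2l ?exprn_ge0 ?(ltW r0) //.
rewrite -natrX ler_nat; apply: leq_trans (_ : (mdeg a).+1 <= _)%N.
  by rewrite ltnS mdegE (bigD1 i) //= leq_addr.
exact: ltn_expl.
Qed.

End ConvergentSeries.
Arguments cvps {R K v} av {n}.

(** * Weierstrass division *)

Lemma wf_fixpoint (A B : Type) (w : A -> nat) (T : (A -> B) -> A -> B) (b0 : B) :
    (forall q q' a, (forall b, (w b < w a)%N -> q b = q' b) -> T q a = T q' a) ->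
  exists q, forall a, q a = T q a.
Proof.
move=> HT; pose q k := iter k T (fun=> b0); exists (fun a => q (w a).+1 a).
have stable m : forall a k, (w a < m)%N -> (w a < k)%N -> q k a = q (w a).+1 a.
  elim: m => // m IHm a [|k] // am ak; apply: HT => b ba.
  have bm : (w b < m)%N by apply: leq_trans ba _.
  transitivity (q (w b).+1 b); first by apply: IHm => //; apply: leq_trans ba _.
  exact/esym/IHm.
by move=> a; apply: HT => b ba; apply: (stable (w a)).
Qed.

Section Weierstrass.
Variables (n : nat) (K : fieldType) (i0 : 'I_n) (d : nat).
Implicit Types (f g : mps n K) (a b : 'X_{1..n}).

Local Notation e k := (U_(i0) *+ k)%MM.

(** Weierstrass regularity of order [d]: [d] is the order of [g] on the axis of
    the variable [i0]. *)
Definition regular g := (forall k, (k < d)%N -> g (e k) = 0) /\ g (e d) != 0.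

Let wgt a := (\sum_i a i * (if i == i0 then 1 else d.+1))%N.

Let wgtD a b : wgt (a + b)%MM = (wgt a + wgt b)%N.
Proof. by rewrite -big_split; apply: eq_bigr => i _; rewrite /= mnmDE mulnDl. Qed.

Let e_i0 k : e k i0 = k.
Proof. by rewrite mulmnE mnm1E eqxx mul1n. Qed.

Let e_neq k i : i != i0 -> e k i = 0%N.
Proof. by move=> ii0; rewrite mulmnE mnm1E eq_sym (negPf ii0). Qed.

Let wgt_e k : wgt (e k) = k.
Proof.
rewrite /wgt (bigD1 i0) //= eqxx muln1 e_i0 big1 ?addn0 // => i ii0.
by rewrite e_neq.
Qed.

Let mdeg_e k : mdeg (e k) = k.
Proof. by rewrite mdegMn mdeg1 mul1n. Qed.

Let mdeg_wgt a : (mdeg a <= wgt a)%N.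
Proof.
by rewrite mdegE; apply: leq_sum => i _; case: eqP; rewrite ?muln1 ?leq_pmulr.
Qed.

Let wgt_mdeg a : (wgt a <= d.+1 * mdeg a)%N.
Proof.
rewrite mdegE big_distrr /=; apply: leq_sum => i _.
by rewrite mulnC; case: eqP => _ //; rewrite mul1n leq_pmull.
Qed.

(** The weights make the leading monomial of a regular series the only one of
    weight at most [d]. *)
Let wgt_term g b : regular g -> b != e d -> g b != 0 -> (d < wgt b)%N.
Proof.
move=> [glow _] bd gb.
have [/forallP pure|] := boolP [forall i, (i != i0) ==> (b i == 0%N)].
  have bE : b = e (b i0).
    apply/mnmP => i; have [->|ii0] := eqVneq i i0; first by rewrite e_i0.
    by rewrite e_neq //; have /implyP/(_ ii0)/eqP := pure i.
  rewrite bE wgt_e ltnNge leq_eqVlt; apply/negP => /orP[/eqP bd'|bd'].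
    by rewrite bE bd' eqxx in bd.
  by rewrite bE glow ?eqxx in gb.
rewrite negb_forall => /existsP [i]; rewrite negb_imply -lt0n => /andP[ii0 bi].
by rewrite /wgt (bigD1 i) //= (negPf ii0) ltn_addr // leq_pmull.
Qed.

Let S (q : 'X_{1..n} -> K) g m a := \sum_(b : 'X_{1..n < m, m} |
  ((a + e d)%MM == (b.1 + b.2)%MM) && (bmnm b.1 != e d)) g b.1 * q b.2.

Let wlt g a b b' : regular g -> (a + e d)%MM = (b + b')%MM -> b != e d ->
  g b != 0 -> (wgt b' < wgt a)%N.
Proof.
move=> greg /(congr1 wgt); rewrite !wgtD wgt_e => ab be gb.
by have := wgt_term greg be gb; lia.
Qed.

Let gM g q m a : (mdeg a + d < m)%N ->
  (g * MPS q) (a + e d)%MM = g (e d) * q a + S q g m a.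
Proof.
move=> am; have em : (mdeg (e d) < m)%N.
  by rewrite mdeg_e; apply: leq_ltn_trans (leq_addl _ _) am.
have am' : (mdeg a < m)%N by apply: leq_ltn_trans (leq_addr _ _) am.
have aem : (mdeg (a + e d)%MM < m)%N by rewrite mdegD mdeg_e.
rewrite (coefM _ _ aem) (bigD1 (BMultinom em, BMultinom am')) /=; last first.
  by rewrite addmC.
congr (_ + _); apply: eq_bigl => -[b b'] /=; apply: andb_id2l => /eqP ab.
congr (~~ _); apply/eqP/eqP => [[-> _] //|bd]; congr pair; apply: val_inj => //=.
by move: ab; rewrite bd addmC => /addmI.
Qed.

(** The monomial of least weight of [q], multiplied by the leading monomial of
    [g], would survive in [g * q]. *)
Lemma weierstrass_uniq g q : regular g ->
  (forall a, (g * q) (a + e d)%MM = 0) -> q = 0.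
Proof.
move=> greg gq0; apply: mpsP => a; have [_ gd0] := greg.
move: {2}(wgt a).+1 (ltnSn (wgt a)) => k; elim: k a => // k IH a ak.
have qE : q = MPS q by case: (q).
have := gq0 a; rewrite {1}qE (gM _ _ (ltnSn _)) /S big1 ?addr0.
  by move/eqP; rewrite mulf_eq0 (negPf gd0) => /eqP.
move=> b /andP[/eqP ab bd]; have [->|gb] := eqVneq (g b.1) 0; first by rewrite mul0r.
by rewrite IH ?mulr0 //; apply: leq_trans (wlt greg ab bd gb) _.
Qed.

Lemma regular_mul_low g q k : regular g -> (k < d)%N -> (g * q) (e k) = 0.
Proof.
move=> greg kd; rewrite (coefM _ _ (ltnSn _)) big1 // => -[b b'] /= /eqP ek.
have [->|gb] := eqVneq (g b) 0; first by rewrite mul0r.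
move: (bmnm b) (bmnm b') ek gb => {b'} b b' ek gb.
have wk : (wgt b <= k)%N by rewrite -(wgt_e k) ek wgtD leq_addr.
have [bd|bd] := eqVneq b (e d); first by move: wk; rewrite bd wgt_e; lia.
by have := wgt_term greg bd gb; lia.
Qed.

Lemma regular_mul_lead g q : regular g -> (g * q) (e d) = g (e d) * cst q.
Proof.
move=> greg; have qE : q = MPS q by case: (q).
have H : (g * MPS q) (0 + e d)%MM = g (e d) * q 0%MM + S q g d.+1 0%MM.
  by apply: gM; rewrite mdeg0.
rewrite {1}qE -{1}[e d]add0m H /S big1 ?addr0 // => b /andP[/eqP ab bd].
have [->|gb] := eqVneq (g b.1) 0; first by rewrite mul0r.
have := wlt greg ab bd gb; rewrite {2}/wgt big1 // => i _.
by rewrite mnm0E mul0n.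
Qed.

(** Weierstrass division. The quotient is the solution of a fixed point
    equation that determines the coefficients by recursion on the weight; for
    radii [r * s ^ w], where [w] is the weight of the variable, and [s] small
    this equation is a contraction for the sum norm. *)
Lemma weierstrass_div f g : regular g ->
  exists q, (forall a, (f - g * q) (a + e d)%MM = 0) /\
    forall (R : realType) (v : K -> R) (av : absolute_value v),
      f \in cvps av -> g \in cvps av -> q \in cvps av.
Proof.
move=> greg; have [_ gd0] := greg; pose c := g (e d).
pose E a := (mdeg a + d).+1.
have [|Q QE] := @wf_fixpoint _ K wgt
    (fun q a => c^-1 * (f (a + e d)%MM - S q g (E a) a)) 0.
  move=> q q' a qq; congr (_ * (_ - _)); apply: eq_bigr => b /andP[/eqP ab bd].
  have [->|gb] := eqVneq (g b.1) 0; first by rewrite !mul0r.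
  by rewrite (qq b.2) //; apply: wlt greg ab bd gb.
have QS m a : (mdeg a + d < m)%N -> c * Q a = f (a + e d)%MM - S Q g m a.
  move=> am; apply/eqP; rewrite eq_sym subr_eq -(gM _ _ am) (@gM _ _ (E a)) //.
  by rewrite -/c {1}QE mulrA divff // mul1r subrK.
exists (MPS Q); split=> [a|R v av fcv gcv].
  by rewrite coefB (@gM _ _ (E a)) // -/c (QS (E a)) // subrK subrr.
have [r [C [r0 C0 HC]]] := cvps_bound2 fcv gcv.
have vc : 0 < v c := av_gt0 av gd0.
pose X := v c * r ^+ d; have X0 : 0 < X by rewrite mulr_gt0 ?exprn_gt0.
pose s := X / (X + 2 * (C + 1)).
have den0 : 0 < X + 2 * (C + 1) by lra.
have s0 : 0 < s by rewrite divr_gt0.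
have s1 : s <= 1 by rewrite ler_pdivrMr // mul1r; lra.
have Cs : C * s * 2 <= X.
  have sE : s * (X + 2 * (C + 1)) = X by rewrite divfK // gt_eqF.
  have sX : 0 < s * X by rewrite mulr_gt0.
  nra.
clearbody s; pose t := r * s; have t0 : 0 < t by rewrite mulr_gt0.
pose H a := v (Q a) * (r ^+ mdeg a * s ^+ wgt a).
have rs_ge0 a : 0 <= r ^+ mdeg a * s ^+ wgt a.
  by rewrite mulr_ge0 // exprn_ge0 // ltW.
have H0 a : 0 <= H a by rewrite mulr_ge0 ?(av_ge0 av).
have rsD a b : r ^+ mdeg (a + b)%MM * s ^+ wgt (a + b)%MM =
    (r ^+ mdeg a * s ^+ wgt a) * (r ^+ mdeg b * s ^+ wgt b).
  by rewrite mdegD wgtD !exprD mulrACA.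
have rse : r ^+ mdeg (e d) * s ^+ wgt (e d) = t ^+ d.
  by rewrite mdeg_e wgt_e /t exprMn.
pose B := 2 * C / (v c * t ^+ d).
have td0 : 0 < v c * t ^+ d by rewrite mulr_gt0 // exprn_gt0.
suff HB D : \sum_(a : 'X_{1..n < D + d.+1} | (wgt a < D)%N) H a <= B.
  apply: (@bound_cvps _ _ _ _ _ _ (r * s ^+ d.+1) B) => [|D].
    by rewrite mulr_gt0 // exprn_gt0.
  apply: le_trans (HB (d.+1 * D)%N).
  have DM : (D <= d.+1 * D + d.+1)%N.
    by apply: leq_trans (leq_addr _ _); rewrite leq_pmull.
  pose h (a : 'X_{1..n < D}) : 'X_{1..n < d.+1 * D + d.+1} :=
    BMultinom (leq_trans (bmdeg a) DM).
  have h_inj : injective h.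
    by move=> a b /(congr1 (@bmnm _ _)) /= ab; apply: val_inj.
  pose H' (a : 'X_{1..n < d.+1 * D + d.+1}) := if (wgt a < d.+1 * D)%N then H a else 0.
  have H'0 x : 0 <= H' x by rewrite /H'; case: ifP.
  rewrite [leRHS]big_mkcond /= -/H'; apply: le_trans (ler_sum_inj predT h_inj H'0).
  apply: ler_sum => a _; rewrite /H' /=.
  have -> : (wgt a < d.+1 * D)%N.
    apply: leq_ltn_trans (wgt_mdeg a) _; rewrite ltn_mul2l /=; exact: bmdeg.
  rewrite /H ler_wpM2l ?(av_ge0 av) // exprMn -exprM.
  apply: ler_wpM2l; first by rewrite exprn_ge0 // ltW.
  by apply: ler_wiXn2l => //; exact: ltW.
pose M := (D + d.+1)%N; rewrite -/M big_mkcond /=.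
pose H' a := if (wgt a < D)%N then H a else 0.
have H'0 a : 0 <= H' a by rewrite /H'; case: ifP.
pose N := \sum_(a : 'X_{1..n < M}) H' a; rewrite -[leLHS]/N.
have N0 : 0 <= N by apply: sumr_ge0.
pose G b := v (g b) * r ^+ mdeg b * s ^+ d.+1.
have G0 b : 0 <= G b by rewrite !mulr_ge0 ?(av_ge0 av) ?exprn_ge0 // ltW.
pose F (a : 'X_{1..n}) := v (f (a + e d)%MM) * r ^+ mdeg (a + e d)%MM.
pose p (b : 'X_{1..n < M, M}) := (b.1 + b.2)%MM.
(* for small [s] the double sum is at most half of the left-hand side: see [stepG]
   and [half] *)
have step : v c * t ^+ d * N <= \sum_(a : 'X_{1..n < M}) F a +
    \sum_(a : 'X_{1..n < M}) \sum_(b : 'X_{1..n < M, M} | (a + e d)%MM == p b)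
      G b.1 * H' b.2.
  rewrite -big_split /N mulr_sumr; apply: ler_sum => a _ /=.
  have F0 : 0 <= F a by rewrite mulr_ge0 ?(av_ge0 av) ?exprn_ge0 // ltW.
  have S0 : 0 <= \sum_(b : 'X_{1..n < M, M} | (a + e d)%MM == p b) G b.1 * H' b.2.
    by apply: sumr_ge0 => b _; rewrite mulr_ge0.
  rewrite /H'; case: ifP => [aD|_]; last by rewrite mulr0 addr_ge0.
  have aM : (mdeg a + d < M)%N.
    have := leq_ltn_trans (mdeg_wgt a) aD; move: (mdeg a) => k.
    by rewrite /M => /ltnW kD; rewrite addnS ltnS leq_add2r.
  have -> : v c * t ^+ d * H a = v (c * Q a) *
      (r ^+ mdeg (a + e d)%MM * s ^+ wgt (a + e d)%MM).
    by rewrite /H (avM av) rsD rse; ring.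
  rewrite (QS M) //; apply: le_trans (ler_wpM2r (rs_ge0 _) (avB av _ _)) _.
  rewrite mulrDl; apply: lerD.
    rewrite /F mulrA ler_piMr //.
    by rewrite exprn_ile1 // ltW.
  apply: le_trans (ler_wpM2r (rs_ge0 _) (av_sum av _ _ _)) _.
  rewrite mulr_suml big_mkcondr /=; apply: ler_sum => b ab.
  case: ifP => [bd|_]; last by rewrite mulr_ge0 // /H'; case: ifP.
  have [->|gb] := eqVneq (g b.1) 0.
    by rewrite mul0r (av0 av) mul0r mulr_ge0 // /H'; case: ifP.
  rewrite (ltn_trans (wlt greg (eqP ab) bd gb) aD) (eqP ab) rsD (avM av).
  rewrite mulrACA /H; apply: ler_wpM2r; first exact: H0.
  rewrite /G mulrA; apply: ler_wpM2l.
    by rewrite mulr_ge0 ?(av_ge0 av) ?exprn_ge0 // ltW.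
  by apply: ler_wiXn2l; [exact: ltW| |exact: (wgt_term greg bd gb)].
have stepF : \sum_(a : 'X_{1..n < M}) F a <= C.
  have [HCf _] := HC (M + d)%N; apply: le_trans HCf.
  have hlt (a : 'X_{1..n < M}) : (mdeg (a + e d)%MM < M + d)%N.
    by rewrite mdegD mdeg_e ltn_add2r bmdeg.
  pose h (x : 'X_{1..n < M}) : 'X_{1..n < M + d} := BMultinom (hlt x).
  apply: (@ler_sum_inj R _ _ h predT
      (fun b : 'X_{1..n < M + d} => v (f b) * r ^+ mdeg b)).
    by move=> a b /(congr1 (@bmnm _ _)) /= /addIm ab; apply: val_inj.
  by move=> b; rewrite mulr_ge0 ?(av_ge0 av) ?exprn_ge0 // ltW.
have stepG : \sum_(a : 'X_{1..n < M}) \sum_(b : 'X_{1..n < M, M} |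
    (a + e d)%MM == p b) G b.1 * H' b.2 <= C * s ^+ d.+1 * N.
  rewrite (exchange_big_dep predT) //=.
  apply: (@le_trans _ _ (\sum_(b : 'X_{1..n < M, M}) G b.1 * H' b.2)).
    apply: ler_sum => b _; apply: sum_at_most_one; first by rewrite mulr_ge0.
    by move=> a a' /eqP ab /eqP; rewrite -ab => /addIm aa; apply: val_inj.
  rewrite -(pair_big predT predT (fun x y : 'X_{1..n < M} => G x * H' y)) /=.
  rewrite -big_distrlr /= -/N ler_wpM2r // /G -mulr_suml.
  have [_ HCg] := HC M; rewrite ler_wpM2r ?exprn_ge0 // ltW //.
have half : C * s ^+ d.+1 * 2 <= v c * t ^+ d.
  rewrite /t exprMn mulrA -/X exprS mulrA mulrAC ler_wpM2r // exprn_ge0 // ltW //.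
have := le_trans step (lerD stepF stepG).
rewrite /B ler_pdivlMr // => le1.
have := ler_wpM2r N0 half; lra.
Qed.

End Weierstrass.

(** * Variables indexed by a finite type *)

Section FinTypeVariables.
Variable K : fieldType.
Local Notation ps J := (mps #|(J : finType)| K).

(** Series in the variables [J] are series in [#|J|] variables. Sums, products
    and options of index types then name the unknowns, without arithmetic on
    ordinals. *)
Definition var (J : finType) (j : J) : ps J := mps_var K (enum_rank j).
Definition pder (J : finType) (j : J) (f : ps J) : ps J := deriv (enum_rank j) f.
Definition sub (J : finType) n (g : J -> mps n K) (f : ps J) : mps n K :=
  ev (fun i => g (enum_val i)) f.

Fact pder_zmod_morphism (J : finType) (j : J) : zmod_morphism (@pder J j).
Proof. exact: deriv_zmod_morphism. Qed.
HB.instance Definition _ (J : finType) (j : J) :=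
  GRing.isZmodMorphism.Build _ _ (@pder J j) (@pder_zmod_morphism J j).

Fact sub_zmod_morphism J n g : zmod_morphism (@sub J n g).
Proof. exact: ev_zmod_morphism. Qed.
Fact sub_monoid_morphism J n g : monoid_morphism (@sub J n g).
Proof. exact: ev_monoid_morphism. Qed.
HB.instance Definition _ J n g :=
  GRing.isZmodMorphism.Build _ _ (@sub J n g) (@sub_zmod_morphism J n g).
HB.instance Definition _ J n g :=
  GRing.isMonoidMorphism.Build _ _ (@sub J n g) (@sub_monoid_morphism J n g).

Section Rules.
Variables (J : finType) (n : nat).
Implicit Types (f : ps J) (g : J -> mps n K).

Lemma subC g c : sub g (mpsC _ c) = mpsC n c. Proof. exact: evC. Qed.

Lemma sub_var g j : cst (g j) = 0 -> sub g (var j) = g j.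
Proof. by move=> gj; rewrite /sub ev_var enum_rankK. Qed.

Lemma cst_sub g f : cst (sub g f) = cst f. Proof. exact: cst_ev. Qed.

Lemma cst_pvar j : cst (@var J j) = 0. Proof. exact: cst_var. Qed.

Lemma eq_sub g h f : g =1 h -> sub g f = sub h f.
Proof. by move=> /funext ->. Qed.

Lemma pderM j f f' : pder j (f * f') = pder j f * f' + f * pder j f'.
Proof. exact: derivM. Qed.

Lemma pderC j c : pder j (mpsC #|J| c) = 0. Proof. exact: derivC. Qed.

Lemma pder_var i j : pder i (@var J j) = (i == j)%:R.
Proof. by rewrite /pder /var deriv_var (inj_eq enum_rank_inj). Qed.

Lemma sub_id f : sub (@var J) f = f.
Proof.
rewrite -[RHS]ev_id; apply: eq_ev => i; by rewrite /var enum_valK.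
Qed.

End Rules.

Lemma sub_sub (I J : finType) n (h : I -> mps n K) (g : J -> ps I) f :
  sub h (sub g f) = sub (fun j => sub h (g j)) f.
Proof. exact: ev_ev. Qed.

Lemma pder_sub (I J : finType) (l : I) (g : J -> ps I) f :
  pder l (sub g f) = \sum_j sub g (pder j f) * pder l (g j).
Proof.
rewrite /pder /sub deriv_ev (reindex (@enum_rank J)) /=; last first.
  by exists enum_val => i _; rewrite (enum_rankK, enum_valK).
by apply: eq_bigr => j _; rewrite enum_rankK.
Qed.

Lemma cst_pder_sub (I J : finType) (l : I) (g : J -> ps I) f :
  cst (pder l (sub g f)) = \sum_j cst (pder j f) * cst (pder l (g j)).
Proof.
by rewrite pder_sub rmorph_sum; apply: eq_bigr => j _; rewrite rmorphM /= cst_sub.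
Qed.

Section Convergence.
Variables (R : realType) (v : K -> R) (av : absolute_value v).

Lemma cv_var (J : finType) (j : J) : var j \in cvps av.
Proof. exact: cvps_var. Qed.

Lemma cv_sub (J : finType) n (g : J -> mps n K) f :
  f \in cvps av -> (forall j, g j \in cvps av) -> sub g f \in cvps av.
Proof. by move=> fcv gcv; apply: cvps_ev. Qed.

Lemma cv_pder (J : finType) (j : J) f : f \in cvps av -> pder j f \in cvps av.
Proof. exact: cvps_deriv. Qed.

End Convergence.

Lemma coef_keep (J : finType) (P : pred J) (f : ps J) a :
  sub (fun j => if P j then var j else 0) f a =
  if [forall j, P j || (a (enum_rank j) == 0%N)] then f a else 0.
Proof.
have c0 (i : 'I_#|J|) : cst (if P (enum_val i) then var (enum_val i) else 0) = 0.
  by case: ifP; rewrite ?rmorph0 ?cst_pvar.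
rewrite /sub evE // (@mps_substE _ _ _ _ _ _ (mdeg a).+1) //.
pose ok (b : 'X_{1..#|J|}) := [forall j, P j || (b (enum_rank j) == 0%N)].
rewrite -/(ok a).
have prodE (b : 'X_{1..#|J|}) : \prod_(i < #|J|)
    (if P (enum_val i) then var (enum_val i) else 0) ^+ b i =
    (if ok b then pol 'X_[b] else 0) :> ps J.
  case: ifP => [/forallP okb|/negbT]; last first.
    rewrite negb_forall => /existsP [j]; rewrite negb_or => /andP[/negPf Pj bj].
    rewrite (bigD1 (enum_rank j)) //= enum_rankK Pj expr0n (negPf bj) /=.
    by rewrite mul0r.
  rewrite mpolyXE_id rmorph_prod; apply: eq_bigr => i _ /=.
  rewrite rmorphXn /= pol_X; have := okb (enum_val i); rewrite enum_valK.
  by rewrite /var enum_valK; case: ifP => //= _ /eqP ->; rewrite !expr0.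
under eq_bigr do rewrite prodE.
rewrite (bigD1 (BMultinom (ltnSn (mdeg a)))) //= big1 => [|b ba].
  by rewrite addr0; case: ifP; rewrite ?mulr0 //= mcoeffX eqxx mulr1.
case: ifP; rewrite ?mulr0 //= mcoeffX => _.
case: eqP => [ab|]; last by rewrite mulr0.
by case/eqP: ba; apply: val_inj.
Qed.

Lemma coef_mulX n (i : 'I_n) k (f : mps n K) a :
  (f * mps_var K i ^+ k) a =
  if (k <= a i)%N then f (a - U_(i) *+ k)%MM else 0.
Proof.
have -> : mps_var K i ^+ k = pol 'X_[U_(i) *+ k] by rewrite -mpolyXn rmorphXn /= pol_X.
rewrite (coefM _ _ (ltnSn (mdeg a))); case: ifP => ka.
  have kle : (U_(i) *+ k <= a)%MM.
    apply/mnm_lepP => j; rewrite mulmnE mnm1E; case: eqP => [<-|]; lia.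
  have h1 : (mdeg (a - U_(i) *+ k)%MM < (mdeg a).+1)%N by rewrite ltnS mdegB.
  have h2 : (mdeg (U_(i) *+ k)%MM < (mdeg a).+1)%N.
    by rewrite ltnS -{1}(submK kle) mdegD leq_addl.
  rewrite (bigD1 (BMultinom h1, BMultinom h2)) /=; last by rewrite submK.
  rewrite mcoeffX eqxx mulr1 big1 ?addr0 // => -[b c] /= /andP[/eqP ab ne].
  rewrite mcoeffX; case: eqP => [cE|]; last by rewrite mulr0.
  case/eqP: ne; congr pair; apply: val_inj => //=.
  by move: ab; rewrite -cE => /(congr1 (fun x => x - U_(i) *+ k)%MM); rewrite addmK.
rewrite big1 // => -[b c] /= /eqP ab; rewrite mcoeffX; case: eqP => [cE|].
  by rewrite ab -cE mnmDE mulmnE mnm1E eqxx mul1n leq_addl in ka.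
by rewrite mulr0.
Qed.

Definition opt T (J : Type) (x : T) (g : J -> T) (o : option J) : T :=
  if o is Some j then g j else x.
Definition cop T (I J : Type) (g : I -> T) (h : J -> T) (s : I + J) : T :=
  match s with inl i => g i | inr j => h j end.

(** * Division in a distinguished variable *)

Section DistinguishedVariable.
Variable J : finType.
Implicit Types (g q r : ps (option J)).
Implicit Types a : 'X_{1..#|(option J : finType)|}.

Local Notation i0 := (enum_rank (None : option J)).
Local Notation z := (var (None : option J)).

(** [up] adds the distinguished variable [None]; [down] sets it to zero. *)
Definition up (f : ps J) : ps (option J) := sub (fun j => var (Some j)) f.
Definition down (f : ps (option J)) : ps J := sub (opt 0 (@var J)) f.

Fact up_zmod_morphism : zmod_morphism up.
Proof. exact: sub_zmod_morphism. Qed.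
Fact up_monoid_morphism : monoid_morphism up.
Proof. exact: sub_monoid_morphism. Qed.
HB.instance Definition _ :=
  GRing.isZmodMorphism.Build _ _ up up_zmod_morphism.
HB.instance Definition _ :=
  GRing.isMonoidMorphism.Build _ _ up up_monoid_morphism.

Lemma upK : cancel up down.
Proof.
move=> f; rewrite /up /down sub_sub -[RHS]sub_id; apply: eq_sub => j.
by rewrite sub_var //= cst_pvar.
Qed.

Lemma up_downE (f : ps (option J)) a : up (down f) a = if a i0 == 0%N then f a else 0.
Proof.
rewrite /up /down sub_sub.
rewrite (_ : sub _ f = sub (fun o => if isSome o then var o else 0) f).
  rewrite coef_keep; congr (if _ then _ else _); apply/forallP/idP => [/(_ None) //|].
  by move=> a0 [j|].
apply: eq_sub => -[j|] /=; first by rewrite sub_var ?cst_pvar.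
by rewrite rmorph0.
Qed.

Lemma coef_up (f : ps J) a : a i0 != 0%N -> up f a = 0.
Proof. by move=> a0; rewrite -[f]upK up_downE (negPf a0). Qed.

Lemma cst_up (f : ps J) : cst (up f) = cst f. Proof. exact: cst_sub. Qed.

Lemma coef_up_mulX (f : ps J) k a :
  (up f * z ^+ k) a = if a i0 == k then up f (a - U_(i0) *+ k)%MM else 0.
Proof.
rewrite /var coef_mulX; case: ltngtP => // ka.
by rewrite coef_up // mnmBE mulmnE mnm1E eqxx mul1n subn_eq0 -ltnNge.
Qed.

Section Regular.
Local Notation regz d g := (regular i0 d g).

(** Regularity only depends on the restriction to the axis of [z]. *)
Lemma regular_congr d g g' :
  sub (opt z (fun=> 0)) g = sub (opt z (fun=> 0)) g' -> regz d g -> regz d g'.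
Proof.
have E (h : ps (option J)) k :
    sub (opt z (fun=> 0)) h (U_(i0) *+ k)%MM = h (U_(i0) *+ k)%MM.
  rewrite (_ : sub _ h = sub (fun o => if ~~ isSome o then var o else 0) h).
    rewrite coef_keep ifT //; apply/forallP => -[j|] //=.
    by rewrite mulmnE mnm1E (inj_eq enum_rank_inj) /= mul0n.
  by apply: eq_sub => -[].
by move=> /(congr1 (@mps_coef _ _)) gg [glow gd]; split=> [k kd|];
  rewrite -E -gg E //; apply: glow.
Qed.

Lemma regular_mulz d g : regz d g -> regz d.+1 (z * g).
Proof.
move=> [glow gd]; have E k : (z * g) (U_(i0) *+ k)%MM =
    if (0 < k)%N then g (U_(i0) *+ k.-1)%MM else 0.
  rewrite mulrC -[z]expr1 coef_mulX mulmnE mnm1E eqxx mul1n.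
  by case: k => // k; rewrite mulm1n mulmSr addmK.
by split=> [[|k] kd|]; rewrite E //=; apply: glow.
Qed.

Lemma regular_exp d : regz d (z ^+ d).
Proof.
have E k : (z ^+ d) (U_(i0) *+ k)%MM = (k == d)%:R.
  rewrite -[_ ^+ d]mul1r coef_mulX mulmnE mnm1E eqxx mul1n.
  case: leqP => [dk|kd]; last by rewrite ltn_eqF.
  rewrite -[1]/(mps_one _ _) /=; congr (_%:R); congr (nat_of_bool _).
  apply/eqP/eqP => [/(congr1 (fun a => a i0))|->].
    by rewrite mnmBE !mulmnE mnm1E eqxx !mul1n mnm0E; lia.
  by apply/mnmP => i; rewrite mnmBE subnn mnm0E.
by split=> [k kd|]; rewrite E ?eqxx ?oner_neq0 // ltn_eqF.
Qed.

Lemma regular1 g : cst g = 0 -> cst (pder None g) != 0 -> regz 1 g.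
Proof.
move=> g0 g1; split=> [[|//] _|]; first exact: g0.
by move: g1; rewrite cst_deriv.
Qed.

Lemma split_at_zero r : exists q (r0 : ps J), [/\ r = up r0 + z * q,
  forall a, q a = r (a + U_(i0))%MM &
  forall (R : realType) (v : K -> R) (av : absolute_value v),
    r \in cvps av -> q \in cvps av /\ r0 \in cvps av].
Proof.
have [q [qE qcv]] := weierstrass_div r (regular_exp 1).
rewrite expr1 mulm1n in qE qcv; exists q, (down (r - z * q)); split.
- have -> : up (down (r - z * q)) = r - z * q; last by rewrite subrK.
  apply: mpsP => a; rewrite up_downE; case: ifPn => // a0.
  have /submK <- : (U_(i0) <= a)%MM by rewrite lep1mP.
  by rewrite qE.
- move=> a; have := qE a; rewrite coefB => /eqP; rewrite subr_eq0 => /eqP ->.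
  rewrite mulrC -[z]expr1 coef_mulX mnmDE mnm1E eqxx addn1 /= mulm1n addmK //.
move=> R v av rcv; have zcv := cv_var av (None : option J).
have qc := qcv _ _ av rcv zcv; split=> //.
apply: cv_sub; first by rewrite rpredB // rpredM.
by move=> [j|]; [exact: cv_var|exact: rpred0].
Qed.

Lemma low_degree d r : (forall a, r (a + U_(i0) *+ d)%MM = 0) ->
  exists c : 'I_d -> ps J, r = \sum_k up (c k) * z ^+ k /\
  forall (R : realType) (v : K -> R) (av : absolute_value v),
    r \in cvps av -> forall k, c k \in cvps av.
Proof.
elim: d r => [|d IHd] r rd.
  exists (fun=> 0); split=> [|R v av _ []//]; rewrite big_ord0.
  by apply: mpsP => a; have := rd a; rewrite mulm0n addm0.
have [q [r0 [rE qE cv]]] := split_at_zero r.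
have [|c [cE ccv]] := IHd q.
  by move=> a; rewrite qE -addmA -mulmSr.
exists (fun k => opt r0 c (unlift ord0 k)); split=> [|R v av rcv k].
  rewrite big_ord_recl unlift_none /= expr0 mulr1 {1}rE {1}cE mulr_sumr.
  by congr (_ + _); apply: eq_bigr => k _; rewrite liftK /= exprS mulrCA.
have [qcv r0cv] := cv _ _ _ rcv; case: (unlift ord0 k) => //= k'.
exact: ccv.
Qed.

(** Quotient and remainder are formal, and convergent for every absolute value
    for which the data converge: the formal and the convergent division are one
    statement. *)
Theorem weierstrass_division d (f : ps (option J)) g : regz d g ->
  exists q (c : 'I_d -> ps J), f = g * q + \sum_k up (c k) * z ^+ k /\
  forall (R : realType) (v : K -> R) (av : absolute_value v),
    f \in cvps av -> g \in cvps av ->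
    q \in cvps av /\ forall k, c k \in cvps av.
Proof.
move=> greg; have [q [qE qcv]] := weierstrass_div f greg.
have [c [cE ccv]] := low_degree qE; exists q, c; split.
  by rewrite -cE addrC subrK.
move=> R v av fcv gcv; have qc := qcv _ _ _ fcv gcv; split=> //.
by apply: ccv; rewrite rpredB // rpredM.
Qed.

Lemma weierstrass_remainder d g q (c : 'I_d -> ps J) : regz d g ->
  g * q = \sum_k up (c k) * z ^+ k -> forall k, c k = 0.
Proof.
move=> greg gq; have q0 : q = 0.
  apply: (weierstrass_uniq greg) => a; rewrite gq coef_sum big1 // => k _.
  rewrite coef_up_mulX mnmDE mulmnE mnm1E eqxx mul1n ifN //.
  by have := ltn_ord k; lia.
move=> k; suff upc : up (c k) = 0 by rewrite -[c k]upK upc /down rmorph0.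
apply: mpsP => a; case: (eqVneq (a i0) 0%N) => [a0|/coef_up -> //].
have := congr1 (fun h : ps (option J) => h (a + U_(i0) *+ k)%MM) gq.
rewrite q0 mulr0 coef_sum (bigD1 k) // big1 => [|l lk].
  by rewrite [RHS]addr0 coef_up_mulX mnmDE a0 mulmnE mnm1E eqxx mul1n add0n eqxx addmK.
by rewrite coef_up_mulX mnmDE a0 mulmnE mnm1E eqxx mul1n add0n
  val_eqE eq_sym (negPf lk).
Qed.

End Regular.

End DistinguishedVariable.

End FinTypeVariables.
Arguments var {K J} j.
Arguments up {K J} f : simpl never.
Arguments down {K J} f : simpl never.
Arguments sub {K J n} g f : simpl never.
Arguments pder {K J} j f : simpl never.

(** * Implicit functions and Taylor expansion *)

Section ImplicitFunctions.
Variable K : fieldType.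
Local Notation ps J := (mps #|(J : finType)| K).

Lemma sub_zero (J : finType) n (f : ps J) :
  sub (fun=> 0 : mps n K) f = mpsC n (cst f).
Proof.
move: f; apply: (@eq_ev_ext _ _ _ _ _ 0).
- by move=> d f f'; rewrite addn0 => H; apply: ev_eqd.
- move=> [|d] f f'; rewrite addn0 => H a //.
  by rewrite /cst H // mdeg0.
elim/mpoly_ring_ind => [c|i|p p' IH IH'|p p' IH IH'].
- by rewrite subC cstC.
- by rewrite pol_X /sub ev_var ?rmorph0 // cst_var rmorph0.
- by rewrite polD !rmorphD /= IH IH'.
- by rewrite polM !rmorphM /= IH IH'.
Qed.

Section Up.
Variable J : finType.

Lemma sub_up n (w : mps n K) (b : J -> mps n K) (f : ps J) :
  (forall j, cst (b j) = 0) -> sub (opt w b) (up f) = sub b f.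
Proof.
by move=> b0; rewrite /up sub_sub; apply: eq_sub => j; rewrite sub_var /=.
Qed.

Lemma up_var (j : J) : up (var j : ps J) = var (Some j).
Proof. by rewrite /up sub_var ?cst_pvar. Qed.

Lemma down_zvar : down (var None : ps (option J)) = 0.
Proof. by rewrite /down sub_var /= ?rmorph0. Qed.

Lemma pder_up_None (f : ps J) : pder None (up f) = 0.
Proof.
rewrite /up pder_sub big1 // => j _; by rewrite pder_var mulr0.
Qed.

Lemma pder_up (j : J) (f : ps J) : pder (Some j) (up f) = up (pder j f).
Proof.
rewrite /up pder_sub (bigD1 j) //= big1 => [|i ij].
  by rewrite pder_var eqxx mulr1 addr0.
rewrite pder_var; have -> : (Some j == Some i) = false; last by rewrite mulr0.
by apply/eqP => -[ji]; rewrite ji eqxx in ij.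
Qed.

End Up.

(** Weierstrass division of the unknown by the equation: the remainder, which
    does not involve the unknown, is the solution. Substituting any formal zero
    into the division shows that it is this solution, so that existence and
    formal uniqueness come together. *)
Lemma implicit_function1 (B : finType) (Phi : ps (option B)) :
  cst Phi = 0 -> cst (pder None Phi) != 0 ->
  exists r : ps B, [/\ cst r = 0, sub (opt r var) Phi = 0,
    forall n (b : B -> mps n K) w, (forall i, cst (b i) = 0) -> cst w = 0 ->
      sub (opt w b) Phi = 0 -> w = sub b r &
    forall (R : realType) (v : K -> R) (av : absolute_value v),
      Phi \in cvps av -> r \in cvps av].
Proof.
move=> Phi0 Phi1; have reg := regular1 Phi0 Phi1.
have [q [c]] := weierstrass_division (var None) reg.
rewrite big_ord1 expr0 mulr1; set r := c ord0; case=> zE cv.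
have r0 : cst r = 0.
  have := congr1 cst zE.
  by rewrite cst_pvar rmorphD rmorphM /= Phi0 mul0r add0r cst_up => <-.
exists r; split=> //.
- have q0 : cst q != 0.
    have := congr1 (fun f => cst (pder None f)) zE.
    rewrite pder_var eqxx rmorph1 raddfD /= pderM pder_up_None addr0 rmorphD /=.
    rewrite !rmorphM /= Phi0 mul0r addr0 => /esym/eqP q1.
    by apply: contraTneq q1 => ->; rewrite mulr0 eq_sym oner_eq0.
  have var0 (i : B) : cst (var i : ps B) = 0 by apply: cst_pvar.
  have := congr1 (sub (opt r var)) zE; rewrite sub_var //= rmorphD rmorphM /=.
  rewrite (sub_up _ _ var0) sub_id => /eqP; rewrite -subr_eq subrr eq_sym => /eqP.
  case/mps_mul_eq0 => // /(congr1 cst); rewrite cst_sub rmorph0 => qz.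
  by rewrite qz eqxx in q0.
- move=> n b w b0 w0 Phibw; have := congr1 (sub (opt w b)) zE.
  by rewrite sub_var //= rmorphD rmorphM /= Phibw mul0r add0r sub_up.
move=> R v av Phicv.
by have [_ /(_ ord0)] := cv _ _ av (cv_var av (None : option B)) Phicv.
Qed.

(** The case of several unknowns, by elimination of one unknown at a time. The
    Jacobian matrix at the origin is a scalar matrix in the application, and
    this form is preserved by the elimination. *)
Lemma implicit_functions h (B : finType) (Phi : 'I_h -> ps (B + 'I_h)%type)
    (mu : K) : mu != 0 -> (forall i, cst (Phi i) = 0) ->
    (forall i k, cst (pder (inr k) (Phi i)) = mu *+ (i == k)) ->
  exists w : 'I_h -> ps B, [/\ forall i, cst (w i) = 0,
    forall i, sub (cop var w) (Phi i) = 0,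
    forall n (b : B -> mps n K) (u : 'I_h -> mps n K),
      (forall i, cst (b i) = 0) -> (forall k, cst (u k) = 0) ->
      (forall i, sub (cop b u) (Phi i) = 0) -> forall k, u k = sub b (w k) &
    forall (R : realType) (v : K -> R) (av : absolute_value v),
      (forall i, Phi i \in cvps av) -> forall k, w k \in cvps av].
Proof.
move=> mu0; elim: h B Phi => [|h IH] B Phi Phi0 Phi1.
  by exists (fun=> 0); split=> [[]|[]|n b u _ _ _ []|R v av _ []].
pose iota (s : (B + 'I_h.+1)%type) : option (B + 'I_h)%type :=
  match s with inl b => Some (inl b)
             | inr k => omap inr (unlift ord0 k) end.
have iota0 : iota (inr ord0) = None by rewrite /iota unlift_none.
have iotaS k : iota (inr (lift ord0 k)) = Some (inr k) by rewrite /iota liftK.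
have iota_inj : injective iota.
  move=> [b|k] [b'|k'] //=; first by move=> [->].
  - by case: unliftP.
  - by case: unliftP.
  by case: unliftP => [j ->|->]; case: unliftP => [j' ->|->] // [->].
pose ren (f : ps (B + 'I_h.+1)%type) : ps (option (B + 'I_h)%type) :=
  sub (fun s => var (iota s)) f.
have cst_pder_ren s f : cst (pder (iota s) (ren f)) = cst (pder s f).
  rewrite /ren cst_pder_sub (bigD1 s) //= big1 => [|t ts].
    by rewrite pder_var eqxx rmorph1 mulr1 addr0.
  by rewrite pder_var (inj_eq iota_inj) eq_sym (negPf ts) rmorph0 mulr0.
have [||r [r0 Phir runiq rcv]] := @implicit_function1 _ (ren (Phi ord0)).
- by rewrite cst_sub.
- by rewrite -iota0 cst_pder_ren Phi1 eqxx.
pose elim f : ps (B + 'I_h)%type := sub (opt r var) (ren f).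
have small_r (o : option (B + 'I_h)%type) : cst (opt r var o) = 0.
  by case: o => [s|] //=; apply: cst_pvar.
have [||w [w0 Psiw wuniq wcv]] := IH _ (fun i => elim (Phi (lift ord0 i))).
- by move=> i; rewrite !cst_sub.
- move=> i k; rewrite /elim cst_pder_sub.
  have dN : cst (pder None (ren (Phi (lift ord0 i)))) = 0.
    by rewrite -{1}iota0 cst_pder_ren Phi1.
  rewrite (bigD1 None) //= dN mul0r add0r.
  rewrite (bigD1 (Some (inr k))) //= big1 ?addr0 => [|[s|] //].
    rewrite pder_var eqxx rmorph1 mulr1 -iotaS cst_pder_ren Phi1.
    by rewrite (inj_eq lift_inj).
  rewrite eqE /= => sk; rewrite pder_var eq_sym (negPf sk) rmorph0 mulr0 //.
pose W k := if unlift ord0 k is Some k' then w k' else sub (cop var w) r.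
have W0 k : cst (W k) = 0.
  by rewrite /W; case: (unlift ord0 k) => [k'|] //; rewrite cst_sub.
have small_w s : cst (cop var w s) = 0 by case: s => [b|k] //=; apply: cst_pvar.
have WE f : sub (cop var w) (elim f) = sub (cop var W) f.
  rewrite /elim /ren !sub_sub; apply: eq_sub => -[b|k] /=.
    by rewrite sub_var ?small_r //= sub_var ?small_w.
  rewrite /W; case: unliftP => [k' _|_] /=.
    by rewrite sub_var ?small_r //= sub_var ?small_w.
  by rewrite sub_var /= ?cst_sub ?r0.
exists W; split=> //.
- move=> i; case: (unliftP ord0 i) => [i' ->|->]; rewrite -WE; first exact: Psiw.
  by rewrite /elim Phir rmorph0.
- move=> n b u b0 u0 Phiu.
  pose b' (s : (B + 'I_h)%type) := cop b (fun k => u (lift ord0 k)) s.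
  have b'0 s : cst (b' s) = 0 by case: s => [i|k]; [exact: b0|exact: u0].
  have ob'0 o : cst (opt (u ord0) b' o) = 0.
    by case: o => [s|]; [exact: b'0|exact: u0].
  have renE f : sub (opt (u ord0) b') (ren f) = sub (cop b u) f.
    rewrite /ren sub_sub; apply: eq_sub => -[s|k] /=; first by rewrite sub_var.
    by case: unliftP => [k' ->|->] /=; rewrite sub_var.
  have ur : u ord0 = sub b' r by apply: runiq => //; rewrite renE.
  have uw k : u (lift ord0 k) = sub b (w k).
    apply: (wuniq _ b (fun k => u (lift ord0 k))) => // i.
    rewrite -/b' /elim sub_sub -(Phiu (lift ord0 i)) -renE.
    apply: eq_sub => -[s|] /=; first by rewrite sub_var.
    by rewrite -ur.
  move=> k; rewrite /W; case: unliftP => [k' ->|->] //.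
  rewrite ur sub_sub; apply: eq_sub => -[s|k'] /=; first by rewrite sub_var.
  exact: uw.
move=> R v av Phicv.
have rencv i : ren (Phi i) \in cvps av.
  by apply: cv_sub => // s; apply: cv_var.
have rc : r \in cvps av by apply: rcv.
have wc k : w k \in cvps av.
  apply: wcv => i; apply: cv_sub => // -[s|] //=; exact: cv_var.
move=> k; rewrite /W; case: (unlift ord0 k) => [k'|] //.
by apply: cv_sub => // -[s|k'] //=; apply: cv_var.
Qed.

(** Second order Taylor expansion in the variables [J], along [y + a * u]. It
    is obtained by dividing twice by a new variable that stands for [a]. *)
Lemma taylor2 (I J : finType) (f : ps (I + J)%type) :
  exists F : ps (option ((I + J) + J)%type), [/\
    forall n (x : I -> mps n K) (y u : J -> mps n K) (a : mps n K),
      (forall i, cst (x i) = 0) -> (forall j, cst (y j) = 0) ->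
      (forall j, cst (u j) = 0) -> cst a = 0 ->
      sub (cop x (fun j => y j + a * u j)) f = sub (cop x y) f +
        a * (\sum_j sub (cop x y) (pder (inr j) f) * u j) +
        a ^+ 2 * sub (opt a (cop (cop x y) u)) F,
    forall j, cst (pder (Some (inr j)) F) = 0 &
    forall (R : realType) (v : K -> R) (av : absolute_value v),
      f \in cvps av -> F \in cvps av].
Proof.
pose T := option ((I + J) + J)%type.
pose z : ps T := var None.
pose P (s : (I + J)%type) : ps T := match s with
  | inl i => var (Some (inl (inl i)))
  | inr j => var (Some (inl (inr j))) + z * var (Some (inr j)) end.
have P0 s : cst (P s) = 0.
  by case: s => [i|j] /=; rewrite ?rmorphD ?rmorphM /= !cst_pvar ?mulr0 ?addr0.
pose base h : ps ((I + J) + J)%type := sub (fun s => var (inl s)) h.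
have downP h : down (sub P h) = base h.
  rewrite /down sub_sub; apply: eq_sub => -[i|j] /=.
    by rewrite sub_var //= cst_pvar.
  rewrite rmorphD rmorphM /= !sub_var /= ?cst_pvar ?rmorph0 //.
  by rewrite mul0r addr0.
have [q [r0 [FE _ qcv]]] := split_at_zero (sub P f).
have [F [r1 [qE _ Fcv]]] := split_at_zero q.
have r0E : r0 = base f.
  rewrite -downP FE /down rmorphD rmorphM /= -/(down _) -/(down _) upK.
  by rewrite down_zvar mul0r addr0.
have dP s j : pder (Some (inr j)) (P s) = if s == inr j then z else 0.
  case: s => [i|k] /=; rewrite ?raddfD /= ?pderM !pder_var //= mul0r !add0r.
  have -> : (Some (inr j) == Some (inr k) :> T) = (inr k == inr j :> (I + J)%type).
    by apply/eqP/eqP => -[->].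
  by case: (_ == _); rewrite ?mulr1 ?mulr0.
have dPz s : pder None (P s) = if s is inr j then var (Some (inr j)) else 0.
  by case: s => [i|k] /=; rewrite ?raddfD /= ?pderM !pder_var //= mul1r mulr0 add0r addr0.
have r1E : r1 = \sum_j base (pder (inr j) f) * var (inr j).
  have := congr1 (fun h => down (pder None h)) FE.
  rewrite [in RHS]raddfD /= pder_up_None add0r pderM pder_var eqxx mul1r.
  rewrite [in RHS]/down rmorphD rmorphM /= -/(down _) -/(down _) -/(down _).
  rewrite down_zvar mul0r addr0 qE.
  rewrite [in RHS]/down rmorphD rmorphM /= -/(down _) -/(down _) -/(down _).
  rewrite upK down_zvar mul0r addr0 => <-.
  rewrite pder_sub /down rmorph_sum big_sumType /= big1 ?add0r => [|i _].
    apply: eq_bigr => j _; have /= -> := dPz (inr j).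
    by rewrite rmorphM /= -/(down _) downP sub_var //= cst_pvar.
  by have /= -> := dPz (inl i); rewrite mulr0 rmorph0.
exists F; split.
- move=> n x y u a x0 y0 u0 a0; pose pt := opt a (cop (cop x y) u).
  have pt0 t : cst (pt t) = 0 by case: t => [[[i|j]|j]|] /=.
  have cop0 t : cst (cop (cop x y) u t) = 0 by case: t => [[i|j]|j] /=.
  have baseE h : sub (cop (cop x y) u) (base h) = sub (cop x y) h.
    by rewrite /base sub_sub; apply: eq_sub => s; rewrite sub_var.
  have -> : sub (cop x (fun j => y j + a * u j)) f = sub pt (sub P f).
    rewrite sub_sub; apply: eq_sub => -[i|j] /=; first by rewrite sub_var.
    by rewrite rmorphD rmorphM /= !sub_var.
  rewrite FE qE !rmorphD !rmorphM /= !rmorphD !rmorphM /= !sub_up // sub_var // /=.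
  rewrite r0E r1E baseE rmorph_sum mulrDr addrA expr2 !mulrA; congr (_ + _ * _ + _).
  by apply: eq_bigr => j _; rewrite rmorphM /= baseE sub_var.
- move=> j; pose uj : T := Some (inr j).
  have dbase h : pder (inr j) (base h) = 0.
    by rewrite pder_sub big1 // => s _; rewrite pder_var mulr0.
  have dz : pder uj z = 0 by rewrite pder_var.
  have dF : sub P (pder (inr j) f) = up (base (pder (inr j) f)) + z * pder uj F.
    apply: (@mps_mulI _ _ z).
      by apply/eqP => /(congr1 (pder None)); rewrite pder_var eqxx raddf0 => /eqP;
        rewrite oner_eq0.
    transitivity (pder uj (sub P f)).
      rewrite pder_sub (bigD1 (inr j)) //= big1 => [|s sj]; last first.
        by rewrite dP (negPf sj) mulr0.
      by have /= := dP (inr j) j; rewrite eqxx => ->; rewrite addr0 mulrC.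
    rewrite FE qE raddfD /= pderM [pder _ (up r1 + _)]raddfD /= pderM.
    rewrite !pder_up dz !mul0r !add0r r0E dbase.
    rewrite rmorph0 add0r r1E; congr (_ * (up _ + _)).
    rewrite raddf_sum (bigD1 j) //= big1 => [|k kj].
      by rewrite pderM dbase mul0r add0r pder_var eqxx mulr1 addr0.
    rewrite pderM dbase mul0r add0r pder_var -[inr j == inr k]/(j == k).
    by rewrite eq_sym (negPf kj) mulr0.
  have := congr1 (fun h => cst (pder None h)) dF.
  rewrite [in RHS]raddfD /= pder_up_None add0r pderM pder_var eqxx mul1r.
  rewrite [in RHS]rmorphD rmorphM /= cst_pvar mul0r addr0 => <-.
  rewrite cst_pder_sub big1 // => s _; rewrite dPz.
  by case: s => *; rewrite ?rmorph0 ?cst_pvar mulr0.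
move=> R v av fcv.
have cvP : sub P f \in cvps av.
  by apply: cv_sub => // -[i|j] /=; rewrite ?rpredD ?rpredM ?cv_var.
have [qc _] := qcv _ _ _ cvP; by have [] := Fcv _ _ _ qc.
Qed.

End ImplicitFunctions.

(** * Regular coordinates *)

Lemma nat_argmin (T : Type) (A : T -> Prop) (F : T -> nat) :
  (exists a, A a) -> exists2 a, A a & forall b, A b -> (F a <= F b)%N.
Proof.
case=> a0; move: {2}(F a0) (leqnn (F a0)) => k; elim: k a0 => [|k IH] a0 a0k Aa0.
  by exists a0 => // b _; apply: leq_trans a0k _.
have [[b [Ab ba]]|/forallNP H] := pselect (exists b, A b /\ (F b < F a0)%N).
  by apply: (IH b) => //; rewrite -ltnS; apply: leq_trans ba _.
exists a0 => // b Ab; rewrite leqNgt; apply/negP => ba; exact: (H b).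
Qed.

(** Choosing the weights one after the other, each large compared with the
    later ones, makes the weight on [A] minimal at a single multi-index. *)
Lemma separating_weights_seq n (i0 : 'I_n) (L : seq 'I_n) :
  uniq (rcons L i0) -> forall A : 'X_{1..n} -> Prop, (exists a, A a) ->
  exists (w : 'I_n -> nat) (a : 'X_{1..n}), [/\ A a, w i0 = 1%N,
    forall i, (0 < w i)%N &
    forall b, A b -> {in rcons L i0, forall i, b i = a i} \/
      (\sum_(i <- rcons L i0) w i * a i < \sum_(i <- rcons L i0) w i * b i)%N].
Proof.
elim: L => [|j L IH] /= uL A exA.
  have [a Aa amin] := nat_argmin (fun a : 'X_{1..n} => a i0) exA.
  exists (fun=> 1%N), a; split=> // b /amin; rewrite !big_seq1 !mul1n.
  rewrite leq_eqVlt => /orP[/eqP ab|]; last by right.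
  by left=> i; rewrite inE => /eqP ->.
case/andP: uL => jL uL; have [a0 Aa0 amin] := nat_argmin (fun a : 'X_{1..n} => a j) exA.
have [|w [a [[Aa aj] w1 wpos wmin]]] := IH uL (fun a => A a /\ a j = a0 j).
  by exists a0.
pose s := (\sum_(i <- rcons L i0) w i * a i)%N.
pose w' i := if i == j then s.+1 else w i.
have ji0 : i0 != j by apply: contraNneq jL => <-; rewrite mem_rcons mem_head.
have w'E (b : 'X_{1..n}) : (\sum_(i <- rcons L i0) w' i * b i =
    \sum_(i <- rcons L i0) w i * b i)%N.
  rewrite !big_seq; apply: eq_bigr => i iL; rewrite /w' ifN //.
  by apply: contraNneq jL => <-.
exists w', a; split=> //; first by rewrite /w' (negPf ji0).
  by move=> i; rewrite /w'; case: eqP.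
move=> b Ab; rewrite !big_cons !w'E -/s /w' eqxx.
have := amin _ Ab; rewrite leq_eqVlt => /orP[/eqP ab|ab].
  have [|bL|bL] := wmin b; first by split.
    by left=> i; rewrite inE => /orP[/eqP -> |/bL //]; rewrite aj.
  by right; rewrite aj ab ltn_add2l.
right; rewrite aj; apply: (@leq_trans (s.+1 * (a0 j).+1)); first by lia.
by apply: leq_trans (leq_addr _ _); rewrite leq_mul2l ab orbT.
Qed.

Lemma separating_weights n (i0 : 'I_n) (A : 'X_{1..n} -> Prop) :
  (exists a, A a) -> exists (w : 'I_n -> nat) (a : 'X_{1..n}),
    [/\ A a, w i0 = 1%N, forall i, (0 < w i)%N &
    forall b, A b -> b != a -> (\sum_i w i * a i < \sum_i w i * b i)%N].
Proof.
pose L := [seq i <- enum 'I_n | i != i0].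
have uL : uniq (rcons L i0).
  by rewrite rcons_uniq mem_filter eqxx /= filter_uniq // enum_uniq.
have mL i : i \in rcons L i0.
  by rewrite mem_rcons inE mem_filter mem_enum andbT orbN.
move=> /(separating_weights_seq uL) [w [a [Aa w1 wpos wmin]]].
exists w, a; split=> // b /wmin [ba /eqP[]|].
  by apply/mnmP => i; apply: ba.
have sE F : (\sum_(i <- rcons L i0) F i = \sum_i F i)%N.
  by rewrite big_uniq //=; apply: eq_bigl => i; rewrite mL.
by rewrite !sE.
Qed.

Section Coordinates.
Variables (K : fieldType) (J : finType).
Local Notation ps J := (mps #|(J : finType)| K).
Local Notation z := (var (None : option J) : ps (option J)).

(** With separating weights [w], the substitution of [z ^ w_j] for the variable
    [j] keeps a monomial of [g]. The shifts of the variable [j] by [z ^ w_j] have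
    the same effect on the axis of [z], and they are invertible. *)
Lemma regular_coordinates (g : ps (option J)) : g != 0 ->
  exists (phi psi : option J -> ps (option J)) d,
  [/\ (forall o, cst (phi o) = 0) /\ (forall o, cst (psi o) = 0),
      forall o, sub phi (psi o) = var o, forall o, sub psi (phi o) = var o,
      regular (enum_rank (None : option J)) d (sub phi g) &
      forall (R : realType) (v : K -> R) (av : absolute_value v),
        (forall o, phi o \in cvps av) /\ (forall o, psi o \in cvps av)].
Proof.
move=> g0; pose i0 := enum_rank (None : option J).
have [|w [a [ga w1 wpos wmin]]] := @separating_weights _ i0 (fun a => g a != 0).
  by have [a ga _] := mps_min g0; exists a.
pose wt (b : 'X_{1..#|(option J : finType)|}) := (\sum_i w i * b i)%N.
have z0 : cst z = 0 by apply: cst_pvar.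
have zw0 o : cst (z ^+ w (enum_rank o)) = 0.
  by rewrite rmorphXn /= z0 expr0n gtn_eqF.
pose shift s : option J -> ps (option J) :=
  opt z (fun j => var (Some j) + s * z ^+ w (enum_rank (Some j))).
have shift0 s o : cst (shift s o) = 0.
  by case: o => [j|] //=; rewrite rmorphD rmorphM /= zw0 cst_pvar mulr0 addr0.
have shiftK s t : s = 1 \/ s = -1 -> s + t = 0 ->
    forall o, sub (shift s) (shift t o) = var o.
  move=> s1 st [j|] /=; last by rewrite sub_var.
  have -> : t = - s by apply/eqP; rewrite -addr_eq0 addrC st.
  have ss : sub (shift s) s = s.
    by case: s1 => ->; rewrite ?rmorphN rmorph1.
  rewrite rmorphD rmorphM rmorphN rmorphXn /= ss !sub_var ?shift0 //=.
  by rewrite mulNr addrK.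
exists (shift 1), (shift (-1)), (wt a); split.
- by split.
- by apply: shiftK; [left|rewrite subrr].
- by apply: shiftK; [right|rewrite addNr].
- pose theta (o : option J) : ps (option J) := z ^+ w (enum_rank o).
  have theta0 o : cst (theta o) = 0 by apply: zw0.
  have theta_shift : sub (opt z (fun=> 0)) (sub (shift 1) g) = sub theta g.
    rewrite sub_sub; apply: eq_sub => -[j|] /=.
      by rewrite mul1r rmorphD rmorphXn /= !sub_var //= ?rmorph0 // add0r.
    by rewrite sub_var //= /theta w1 expr1.
  have prodE (b : 'X_{1..#|(option J : finType)|}) :
      \prod_i theta (enum_val i) ^+ b i = z ^+ wt b.
    by rewrite expr_sum; apply: eq_bigr => i _; rewrite /theta enum_valK exprM.
  have coefE k : sub theta g (U_(i0) *+ k)%MM =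
      \sum_(b : 'X_{1..#|(option J : finType)| < k.+1} | wt b == k) g b.
    rewrite /sub evE => [|i]; last exact: theta0.
    rewrite (@mps_substE _ _ _ _ _ _ k.+1) => [|i|]; last 2 first.
    + exact: theta0.
    + by rewrite mdegMn mdeg1 mul1n.
    rewrite [RHS]big_mkcond; apply: eq_bigr => b _; rewrite prodE.
    rewrite -[z ^+ _]mul1r coef_mulX mulmnE mnm1E eqxx mul1n.
    case: ltngtP => [bk|bk|bk]; last 1 first.
    + rewrite bk (_ : (_ - _)%MM = 0%MM).
        by rewrite -[(1 : mps _ _) _]/(cst 1) rmorph1 mulr1.
      by apply/mnmP => i; rewrite mnmBE subnn mnm0E.
    + rewrite /= (_ : _ == _ = false) ?mulr0 //; apply/eqP => /mnmP/(_ i0).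
      rewrite mnmBE !mulmnE mnm1E eqxx !mul1n mnm0E => /eqP.
      by rewrite subn_eq0 leqNgt bk.
    + by rewrite mulr0.
  apply: (@regular_congr _ _ _ (sub theta g)).
    rewrite theta_shift sub_sub; apply: eq_sub => o.
    by rewrite rmorphXn /= sub_var.
  split=> [k kd|]; rewrite coefE.
    rewrite big1 // => b /eqP bk; apply/eqP/negPn/negP => gb.
    have [ba|ba] := eqVneq (bmnm b) a; first by rewrite -bk ba ltnn in kd.
    by have := wmin _ gb ba; rewrite -/(wt a) -/(wt b) bk ltnNge (ltnW kd).
  have aw : (mdeg a < (wt a).+1)%N.
    by rewrite ltnS mdegE; apply: leq_sum => i _; rewrite leq_pmull.
  rewrite (bigD1 (BMultinom aw)) //= big1 ?addr0 // => b /andP[/eqP bk ba].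
  apply/eqP/negPn/negP => gb; have := wmin _ gb ba.
  by rewrite -/(wt a) -/(wt b) bk ltnn.
- move=> R v av; have cvs s : s \in cvps av -> forall o, shift s o \in cvps av.
    move=> scv [j|] /=; last exact: cv_var.
    by rewrite rpredD ?cv_var // rpredM // rpredX // cv_var.
  by split; apply: cvs; rewrite ?rpredN rpred1.
Qed.

End Coordinates.

(** * Series that are flat along a formal graph *)

Section FlatSeries.
Variables (K : fieldType) (X S : finType).
Local Notation ps J := (mps #|(J : finType)| K).
Implicit Types (F G H : ps (X + S)%type) (t : S -> ps X).

(** [flat t d F]: the derivatives of [F] of order less than [d] in the
    variables [S] vanish along the graph of [t]. *)
Fixpoint flat t d F : Prop :=
  if d is e.+1 then
    sub (cop var t) F = 0 /\ forall l : S, flat t e (pder (inr l) F)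
  else True.

Lemma flatW t d F : flat t d.+1 F -> flat t d F.
Proof.
elim: d F => // d IH F [F0 dF]; split=> // l; exact/IH/dF.
Qed.

Lemma flatD t d F G : flat t d F -> flat t d G -> flat t d (F + G).
Proof.
elim: d F G => // d IH F G [F0 dF] [G0 dG]; split=> [|l].
  by rewrite rmorphD /= F0 G0 addr0.
by rewrite raddfD; apply: IH; [exact: dF|exact: dG].
Qed.

Lemma flat_sum t d I (r : seq I) (P : pred I) (F : I -> ps (X + S)%type) :
  (forall i, P i -> flat t d (F i)) -> flat t d (\sum_(i <- r | P i) F i).
Proof.
move=> FP; apply: big_ind => //; last exact: flatD.
elim: (d) => // e IH; split=> [|l]; by rewrite ?rmorph0 ?raddf0.
Qed.

Lemma flatM t d H F : flat t d F -> flat t d (H * F).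
Proof.
elim: d H F => // d IH H F dF; have [F0 dF'] := dF; split=> [|l].
  by rewrite rmorphM /= F0 mulr0.
by rewrite pderM; apply: flatD; apply: IH; [exact: flatW|exact: dF'].
Qed.

Lemma flat_cancel t d H F :
  sub (cop var t) H != 0 -> flat t d (H * F) -> flat t d F.
Proof.
move=> H0; elim: d F => // d IH F HF; have [HF0 dHF] := HF; split=> [|l].
  move: HF0; rewrite rmorphM /= => /mps_mul_eq0 [] // Hz.
  by rewrite Hz eqxx in H0.
apply: (IH).
have -> : H * pder (inr l) F =
    pder (inr l) (H * F) + (- pder (inr l) H) * F.
  by rewrite pderM mulNr addrAC subrr add0r.
by apply: flatD (dHF l) _; apply: flatM; apply: (IH); apply: flatW.
Qed.

Hypothesis charK : [pchar K] =i pred0.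

(** Taylor expansion along the graph of [t]: a translation moves the graph to the
    zero section, along which, in characteristic zero, the derivatives determine
    all the coefficients. *)
Lemma flat_eq0 t F : (forall s, cst (t s) = 0) ->
  (forall d, flat t d F) -> F = 0.
Proof.
move=> t0 flF; pose inj (f : ps X) : ps (X + S)%type := sub (fun x => var (inl x)) f.
have inj0 f : cst (inj f) = cst f by apply: cst_sub.
pose T (e : ps (X + S)%type) (s : (X + S)%type) : ps (X + S)%type :=
  match s with inl x => var (inl x) | inr s => var (inr s) + e * inj (t s) end.
have T0 e s : cst (T e s) = 0.
  by case: s => [x|s] /=; rewrite ?rmorphD ?rmorphM /= cst_pvar // inj0 t0 mulr0 addr0.
have T_inj e f : sub (T e) (inj f) = inj f.
  by rewrite /inj sub_sub; apply: eq_sub => x; rewrite sub_var.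
suff G0 : sub (T 1) F = 0.
  have <- : sub (T (-1)) (sub (T 1) F) = F; last by rewrite G0 rmorph0.
  rewrite sub_sub -[RHS]sub_id; apply: eq_sub => -[x|s] /=; first by rewrite sub_var.
  by rewrite mul1r rmorphD /= sub_var // T_inj /= mulN1r subrK.
pose zero (s : S) : ps X := 0.
have var0 (x : X) : cst (var x : ps X) = 0 by apply: cst_pvar.
have cop0 (s : (X + S)%type) : cst (cop var zero s) = 0.
  by case: s => [x|s] //=; rewrite rmorph0.
have fl0 d : flat zero d (sub (T 1) F).
  elim: d F {flF} (flF d) => // d IH F [F0 dF]; split=> [|l].
    rewrite sub_sub -F0; apply: eq_sub => -[x|s] /=; first by rewrite sub_var.
    rewrite mul1r rmorphD /= sub_var //= /zero add0r /inj sub_sub -[RHS]sub_id.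
    by apply: eq_sub => x; rewrite sub_var.
  have -> : pder (inr l) (sub (T 1) F) = sub (T 1) (pder (inr l) F); last exact/IH/dF.
  rewrite pder_sub (bigD1 (inr l)) //= big1 => [|[x|s] sl] /=.
  - by rewrite mul1r raddfD /= pder_var eqxx pder_sub big1 ?addr0 ?mulr1 // => x _;
      rewrite pder_var mulr0.
  - by rewrite pder_var mulr0.
  rewrite mul1r raddfD /= pder_var eq_sym (negPf sl) pder_sub big1 ?addr0 ?mulr0 //.
  by move=> x _; rewrite pder_var mulr0.
move: {F flF}(sub (T 1) F) fl0 => G fl0; apply: mpsP => a.
pose deg (b : 'X_{1..#|((X + S)%type : finType)|}) :=
  (\sum_(s : S) b (enum_rank (inr s : (X + S)%type)))%N.
move: {2}(deg a) (erefl (deg a)) => k; move: (fl0 k.+1) => {fl0}.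
elim: k a G => [|k IH] a G [G0 dG].
  move/eqP; rewrite sum_nat_eq0 => /forallP a0.
  have := congr1 (sub (fun x => var (inl x) : ps (X + S)%type)) G0.
  rewrite rmorph0 sub_sub.
  rewrite (_ : sub _ G = sub (fun s => if s is inl _ then var s else 0) G).
    move=> /(congr1 (fun h : mps _ _ => h a)).
    rewrite (_ : sub _ G = sub (fun s =>
        if (if s is inl _ then true else false) then var s else 0) G).
      rewrite coef_keep ifT //; apply/forallP => -[x|s] //=; exact: a0.
    by apply: eq_sub => -[].
  apply: eq_sub => -[x|s] /=; last by rewrite rmorph0.
  by rewrite sub_var // cst_pvar.
move=> ak; have [l al] : exists l : S, a (enum_rank (inr l : (X + S)%type)) != 0%N.
  apply/existsP; apply: contraPT ak; rewrite negb_exists => /forallP a0.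
  by rewrite /deg big1 // => s _; apply/eqP/negPn/a0.
pose il := enum_rank (inr l : (X + S)%type); pose b := (a - U_(il))%MM.
have ab : a = (b + U_(il))%MM by rewrite submK // lep1mP.
have degb : deg b = k.
  apply/eqP; rewrite -eqSS -ak ab /deg; apply/eqP/esym.
  under eq_bigr do rewrite mnmDE; rewrite big_split /= -addn1; congr addn.
  rewrite (bigD1 l) //= mnm1E eqxx big1 // => s sl.
  by rewrite mnm1E (inj_eq enum_rank_inj) -[inr l == inr s]/(l == s) eq_sym (negPf sl).
have := IH b _ (dG l) degb; rewrite -[pder _ _ _]/(G (b + U_(il))%MM *+ (b il).+1) -ab.
by move/eqP; rewrite -mulr_natr mulf_eq0 ((pcharf0P K).1 charK) orbF => /eqP.
Qed.

End FlatSeries.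

(** * Reduction to a system of maximal Jacobian rank *)

Section Reduction.
Variables (R : realType) (K : fieldType) (v : K -> R) (av : absolute_value v).
Hypothesis charK : [pchar K] =i pred0.
Local Notation ps J := (mps #|(J : finType)| K).

Lemma cvps_det n h (M : 'M[mps n K]_h) :
  (forall i j, M i j \in cvps av) -> \det M \in cvps av.
Proof.
move=> Mcv; apply: rpred_sum => s _; apply: rpredM.
  by rewrite rpredX // rpredN rpred1.
by apply: rpred_prod => i _.
Qed.

Section Point.
Variables (X J : finType) (ybar : J -> ps X).

Definition vanishing (f : ps (X + J)%type) :=
  f \in cvps av /\ sub (cop var ybar) f = 0.

(** [(y, tbar)] exhibits [ybar] as a point of a convergent family of zeros of
    the members of [P]. *)
Record parametrizes (P : ps (X + J)%type -> Prop) (S : finType)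
    (y : J -> ps (X + S)%type) (tbar : S -> ps X) : Prop := Parametrizes {
  param_cv : forall j, y j \in cvps av;
  param_cst : forall j, cst (y j) = 0;
  param_cst_bar : forall s, cst (tbar s) = 0;
  param_zero : forall f, P f -> sub (cop (fun x => var (inl x)) y) f = 0;
  param_bar : forall j, ybar j = sub (cop var tbar) (y j) }.

Definition solvable P :=
  exists (S : finType) (y : J -> ps (X + S)%type) (tbar : S -> ps X),
    parametrizes P y tbar.

Definition jac h (f : 'I_h -> ps (X + J)%type) (c : 'I_h -> J) :
  'M[ps (X + J)%type]_h := \matrix_(i, k) pder (inr (c k)) (f i).

(** The rank, at the formal point [ybar], of the Jacobian matrix of all the
    convergent equations of [ybar], witnessed by a minor. *)
Definition jac_rank_ge h := exists (f : 'I_h -> ps (X + J)%type) (c : 'I_h -> J),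
  (forall i, vanishing (f i)) /\ sub (cop var ybar) (\det (jac f c)) != 0.

Lemma jac_rank0 : jac_rank_ge 0.
Proof.
exists (fun=> 0), (fun i : 'I_0 => False_rect _ (notF (ltn_ord i))).
by split=> [[]//|]; rewrite det_mx00 rmorph1 oner_eq0.
Qed.

Lemma jac_rank_bound h : jac_rank_ge h -> (h <= #|J|)%N.
Proof.
move=> [f [c [_ fc]]]; rewrite -[h]card_ord; apply: (@leq_card _ _ c).
move=> k k' ckk; apply/eqP; apply: contraNT fc => kk.
rewrite -det_tr (determinant_alternate kk) ?rmorph0 // => i.
by rewrite !mxE ckk.
Qed.

(** By maximality of the rank the bordered minors of the system and a further
    equation [g] are again equations of [ybar], and along a parametrized solution
    of the system they express the derivatives of [g] in the parameters. So [g]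
    is flat along [tbar]. *)
Lemma solvable_of_system h (f : 'I_h -> ps (X + J)%type) (c : 'I_h -> J) :
  ~ jac_rank_ge h.+1 -> (forall i, vanishing (f i)) ->
  sub (cop var ybar) (\det (jac f c)) != 0 ->
  solvable (fun g => exists i, g = f i) -> solvable vanishing.
Proof.
move=> hmax fvan fc [S [y [tbar [ycv y0 t0 fy ybarE]]]].
exists S, y, tbar; split=> //.
pose p := cop (fun x => var (inl x)) y : (X + J)%type -> ps (X + S)%type.
pose q := cop var tbar : (X + S)%type -> ps X.
have p0 s : cst (p s) = 0 by case: s => [x|j] //=; apply: cst_pvar.
have q0 s : cst (q s) = 0 by case: s => [x|j] //=; apply: cst_pvar.
have qp g : sub q (sub p g) = sub (cop var ybar) g.
  by rewrite sub_sub; apply: eq_sub => -[x|j] //=; rewrite sub_var.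
pose fg g i := if unlift ord_max i is Some i' then f i' else g.
pose ck k i := if unlift ord_max i is Some i' then c i' else k.
pose E g k := \det (jac (fg g) (ck k)).
have Evan g k : vanishing g -> vanishing (E g k).
  move=> gvan; have fgvan i : vanishing (fg g i).
    by rewrite /fg; case: (unlift _ _).
  split.
    by apply: cvps_det => i j; rewrite mxE; apply: cv_pder; case: (fgvan i).
  apply/eqP/negPn/negP => En; apply: hmax.
  by exists (fg g), (ck k).
pose gam g (i : 'I_h.+1) : ps (X + J)%type := (-1) ^+ (i + (@ord_max h)) *
  \det (\matrix_(i' < h, k' < h) pder (inr (c k')) (fg g (lift i i'))).
have Eexp g k : E g k = \sum_i pder (inr k) (fg g i) * gam g i.
  rewrite /E (expand_det_col _ ord_max); apply: eq_bigr => i _.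
  rewrite !mxE {1}/ck unlift_none /cofactor; congr (_ * (_ * \det _)).
  by apply/matrixP => i' k'; rewrite !mxE /ck liftK.
have gam_max g : gam g ord_max = \det (jac f c).
  rewrite /gam -signr_odd oddD addbb expr0 mul1r; congr (\det _).
  by apply/matrixP => i' k'; rewrite !mxE /fg liftK.
have chain g l : pder (inr l) (sub p g) =
    \sum_k sub p (pder (inr k) g) * pder (inr l) (y k).
  rewrite pder_sub big_sumType /= big1 ?add0r // => x _.
  by rewrite pder_var mulr0.
have key g l : sub p (\det (jac f c)) * pder (inr l) (sub p g) =
    \sum_k pder (inr l) (y k) * sub p (E g k).
  transitivity (\sum_i sub p (gam g i) * pder (inr l) (sub p (fg g i))).
    rewrite (bigD1 ord_max) //= big1 => [|i iM].
      by rewrite addr0 gam_max /fg unlift_none.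
    rewrite /fg; case: unliftP iM => [i' _ _|->]; last by rewrite eqxx.
    have -> : sub p (f i') = 0 by apply: fy; exists i'.
    by rewrite raddf0 mulr0.
  under [RHS]eq_bigr => k _.
    rewrite Eexp rmorph_sum mulr_sumr.
    under eq_bigr do rewrite rmorphM /=.
    over.
  rewrite [RHS]exchange_big; apply: eq_bigr => i _ /=.
  rewrite chain mulr_sumr; apply: eq_bigr => k _.
  by rewrite mulrA mulrC; congr (_ * _); apply: mulrC.
have flat_van d g : vanishing g -> flat tbar d (sub p g).
  elim: d g => // d IH g gvan; split=> [|l].
    by rewrite -/q qp; case: gvan.
  apply: (@flat_cancel _ _ _ _ _ (sub p (\det (jac f c)))); first by rewrite -/q qp.
  rewrite key; apply: flat_sum => k _; apply: flatM; apply: IH; exact: Evan.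
by move=> g gvan; apply: (flat_eq0 charK t0) => d; apply: flat_van.
Qed.

(** Nonzero minors have pairwise distinct columns, so a maximal rank exists. *)
Lemma solvable_by_system :
  (forall h (f : 'I_h -> ps (X + J)%type) (c : 'I_h -> J),
     (forall i, vanishing (f i)) -> sub (cop var ybar) (\det (jac f c)) != 0 ->
     solvable (fun g => exists i, g = f i)) ->
  solvable vanishing.
Proof.
move=> H; have exP : exists h, `[< jac_rank_ge h >].
  by exists 0%N; apply/asboolP; exact: jac_rank0.
have bP h : `[< jac_rank_ge h >] -> (h <= #|J|)%N.
  by move/asboolP; exact: jac_rank_bound.
case: (ex_maxnP exP bP) => h /asboolP [f [c [fvan fc]]] hmax.
apply: (@solvable_of_system h f c) => //; last exact: H fvan fc.
by move=> /asboolP /hmax; rewrite ltnn.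
Qed.

End Point.

End Reduction.

(** * A Newton step with parameters *)

Section Newton.
Variables (R : realType) (K : fieldType) (v : K -> R) (av : absolute_value v).
Local Notation ps J := (mps #|(J : finType)| K).

(** [Y] is an approximate solution: [f] vanishes on it modulo the square of [A],
    and [A] is, up to a unit, the value of [d], where [M] inverts the Jacobian
    matrix up to the factor [d]. The solution is sought as [Y + A * u], where
    [u] is the sum of [A] times new parameters, centered at the constant terms
    of [zbar], and of the unknowns [w]. In the Taylor expansion of [f],
    multiplied by [M], every term is then divisible by [A ^+ 2], and dividing by
    it leaves a system [Phi] whose linear part in [w] at the origin is the
    scalar [cst Q]. The implicit function theorem solves it; by formal
    uniqueness [w] vanishes at the parameters of [ybar], so that [ybar] belongs
    to the family. *)
Lemma newton_step (X S J : finType) h (f : 'I_h -> ps (X + J)%type)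
    (c : 'I_h -> J) (M : 'M[ps (X + J)%type]_h) (d : ps (X + J)%type)
    (ybar : J -> ps X) (A : ps (X + S)%type) (Y : J -> ps (X + S)%type)
    (q : 'I_h -> ps (X + S)%type) (Q : ps (X + S)%type)
    (tbar : S -> ps X) (zbar : J -> ps X) :
  (forall i, f i \in cvps av) -> (forall i k, M i k \in cvps av) ->
  M *m jac f c = d%:M -> jac f c *m M = d%:M ->
  A \in cvps av -> (forall j, Y j \in cvps av) -> (forall i, q i \in cvps av) ->
  Q \in cvps av -> cst A = 0 -> (forall j, cst (Y j) = 0) ->
  (forall s, cst (tbar s) = 0) ->
  (forall i, sub (cop (fun x => var (inl x)) Y) (f i) = A ^+ 2 * q i) ->
  sub (cop (fun x => var (inl x)) Y) d = A * Q -> cst Q != 0 ->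
  sub (cop var tbar) A != 0 ->
  (forall j, ybar j = sub (cop var tbar) (Y j) +
                      sub (cop var tbar) A ^+ 2 * zbar j) ->
  (forall i, sub (cop var ybar) (f i) = 0) ->
  solvable av ybar (fun g => exists i, g = f i).
Proof.
move=> fcv Mcv MJ JM Acv Ycv qcv Qcv A0 Y0 tbar0 fY dY Q0 An0 ybarE fybar.
pose B := (X + (S + J))%type; pose W := (B + 'I_h)%type.
pose emb (s : (X + S)%type) : B := match s with
  inl x => inl x | inr s => inr (inl s) end.
pose iB (g : ps (X + S)%type) : ps B := sub (fun s => var (emb s)) g.
pose iW (g : ps (X + S)%type) : ps W := sub (fun s => var (inl (emb s))) g.
have iW0 g : cst (iW g) = cst g by apply: cst_sub.
pose xW (x : X) : ps W := var (inl (inl x)).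
have xW0 x : cst (xW x) = 0 by apply: cst_pvar.
pose A_ := iW A; pose Y_ j := iW (Y j).
have A_0 : cst A_ = 0 by rewrite iW0.
have Y_0 j : cst (Y_ j) = 0 by rewrite iW0.
pose zW j : ps W := mpsC _ (cst (zbar j)) + var (inl (inr (inr j))).
pose u j : ps W := A_ * zW j + \sum_(k | c k == j) var (inr k).
have u0 j : cst (u j) = 0.
  rewrite rmorphD rmorphM /= A_0 mul0r add0r rmorph_sum big1 // => k _.
  exact: cst_pvar.
pose atY (g : ps (X + J)%type) : ps W := sub (cop xW Y_) g.
have atYE g : atY g = iW (sub (cop (fun x => var (inl x)) Y) g).
  rewrite /iW sub_sub; apply: eq_sub => -[x|j] //=.
  by rewrite sub_var // cst_pvar.
have iWM g g' : iW (g * g') = iW g * iW g' by apply: rmorphM.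
have atYmx (M1 M2 : 'M[ps (X + J)%type]_h) i k :
    atY ((M1 *m M2) i k) = \sum_l atY (M1 i l) * atY (M2 l k).
  rewrite mxE /atY rmorph_sum; apply: eq_bigr => l _; exact: rmorphM.
have [F FE] := choice (fun i => taylor2 (f i)).
pose pnt := opt A_ (cop (cop xW Y_) u).
have pnt0 t : cst (pnt t) = 0 by case: t => [[[x|j]|j]|] /=.
pose tail i := iW (q i) + \sum_j atY (pder (inr j) (f i)) * zW j + sub pnt (F i).
pose Phi i := \sum_l atY (M i l) * tail l + iW Q * var (inr i).
pose Z j := Y_ j + A_ * u j.
have Z0 j : cst (Z j) = 0 by rewrite rmorphD rmorphM /= Y_0 A_0 mul0r addr0.
(* the terms linear in the unknowns recombine to the Jacobian matrix *)
have lin l : \sum_j atY (pder (inr j) (f l)) * u j =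
    A_ * (\sum_j atY (pder (inr j) (f l)) * zW j) +
    \sum_k atY (jac f c l k) * var (inr k).
  under eq_bigr => j _ do rewrite mulrDr mulrCA mulr_sumr.
  rewrite big_split /= mulr_sumr; congr (_ + _).
  rewrite (exchange_big_dep predT) //=; apply: eq_bigr => k _.
  by rewrite (big_pred1 (c k)) ?mxE // => j; rewrite eq_sym.
have ident i : \sum_l atY (M i l) * sub (cop xW Z) (f l) = A_ ^+ 2 * Phi i.
  have -> : A_ ^+ 2 * Phi i = A_ ^+ 2 * (\sum_l atY (M i l) * tail l) +
      A_ * \sum_l atY (M i l) * \sum_k atY (jac f c l k) * var (inr k).
    rewrite mulrDr; congr (_ + _); rewrite expr2 -!mulrA; congr (_ * _).
    transitivity (atY d * var (inr i)).
      by rewrite atYE dY iWM mulrA.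
    have <- : (d%:M : 'M_h) i i = d by rewrite mxE eqxx.
    under [RHS]eq_bigr do rewrite mulr_sumr.
    rewrite exchange_big /= (bigD1 i) //= [X in _ = _ + X]big1 => [|k ki].
      rewrite addr0 -MJ atYmx mulr_suml; apply: eq_bigr => l _.
      by rewrite mulrA.
    transitivity (atY ((d%:M : 'M_h) i k) * var (inr k)).
      rewrite -MJ atYmx mulr_suml; apply: eq_bigr => l _.
      by rewrite mulrA.
    by rewrite mxE eq_sym (negPf ki) mulr0n /atY rmorph0 mul0r.
  rewrite !mulr_sumr -big_split; apply: eq_bigr => l _ /=.
  have [tay _ _] := FE l; rewrite /Z tay // -/(atY _) -/pnt.
  rewrite (_ : \sum_j _ = \sum_j atY (pder (inr j) (f l)) * u j) // lin.
  rewrite (atYE (f l)) fY iWM expr2 iWM -/A_ /tail; ring.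
have tail_pder k l : cst (pder (inr k) (tail l)) = 0.
  have dB (s : B) : pder (inr k) (var (inl s) : ps W) = 0 by rewrite pder_var.
  have diW g : pder (inr k) (iW g) = 0.
    by rewrite /iW pder_sub big1 // => s _; rewrite dB mulr0.
  have datY g : pder (inr k) (atY g) = 0 by rewrite atYE diW.
  rewrite /tail [pder _ (_ + _)]raddfD /= [pder _ (_ + _)]raddfD /= diW add0r.
  rewrite [cst (_ + _)]rmorphD /=.
  rewrite raddf_sum rmorph_sum big1 => [|j _].
    rewrite add0r cst_pder_sub big1 // => -[[[x|j]|j]|] _ /=.
    - by rewrite dB rmorph0 mulr0.
    - by rewrite diW rmorph0 mulr0.
    - by have [_ -> _] := FE l; rewrite mul0r.
    - by rewrite diW rmorph0 mulr0.
  by rewrite /= pderM datY mul0r add0r raddfD /= pderC dB addr0 mulr0 rmorph0.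
pose b (s : B) : ps X := match s with
  | inl x => var x | inr (inl s) => tbar s
  | inr (inr j) => zbar j - mpsC _ (cst (zbar j)) end.
have b0 s : cst (b s) = 0.
  case: s => [x|[s|j]] /=; [exact: cst_pvar|exact: tbar0|].
  by rewrite rmorphB /= cstC subrr.
pose pt := cop b (fun=> 0 : ps X) : W -> ps X.
have pt0 s : cst (pt s) = 0 by case: s => [s|k] /=; rewrite ?rmorph0.
have pt_iW g : sub pt (iW g) = sub (cop var tbar) g.
  by rewrite /iW sub_sub; apply: eq_sub => -[x|s] /=; rewrite sub_var.
have pt_u j : sub pt (u j) = sub (cop var tbar) A * zbar j.
  rewrite rmorphD rmorphM rmorphD rmorph_sum /= pt_iW subC sub_var //.
  rewrite -[pt _]/(zbar j - mpsC _ (cst (zbar j))) [_ + (_ - _)]addrC subrK.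
  by rewrite [X in _ + X]big1 ?addr0 // => k _; rewrite sub_var.
have pt_Z j : sub pt (Z j) = ybar j.
  rewrite rmorphD rmorphM /= pt_u !pt_iW ybarE expr2 mulrA //.
have pt_Phi i : sub pt (Phi i) = 0.
  apply: (@mps_mulI _ _ (sub pt A_ ^+ 2)).
    by rewrite expr2 mps_mul_neq0 // pt_iW.
  rewrite mulr0 -rmorphXn -rmorphM -ident rmorph_sum big1 // => l _.
  rewrite rmorphM /= (_ : sub pt (sub (cop xW Z) _) = 0) ?mulr0 // -(fybar l) sub_sub.
  by apply: eq_sub => -[x|j] /=; rewrite ?sub_var ?pt_Z.
have [||w [w0 wPhi wuniq wcv]] := implicit_functions Q0 (Phi := Phi).
- by move=> i; rewrite -(cst_sub pt) pt_Phi rmorph0.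
- move=> i k; rewrite raddfD raddf_sum /= rmorphD rmorph_sum /= big1 => [|l _].
    rewrite add0r pderM pder_var rmorphD !rmorphM /= cst_pvar mulr0 add0r iW0.
    rewrite -[inr k == inr i]/(k == i) eq_sym.
    by case: (i == k); rewrite ?rmorph1 ?rmorph0 ?mulr1 ?mulr0.
  rewrite pderM rmorphD !rmorphM /= tail_pder mulr0 addr0.
  by rewrite atYE /iW pder_sub big1 ?rmorph0 ?mul0r // => s _; rewrite pder_var mulr0.
pose pw := cop var w : W -> ps B.
have pw0 s : cst (pw s) = 0 by case: s => [s|k] //=; apply: cst_pvar.
have pw_iW g : sub pw (iW g) = iB g.
  by rewrite /iW sub_sub; apply: eq_sub => s; rewrite sub_var.
have wb k : sub b (w k) = 0.
  by rewrite -(wuniq _ b (fun=> 0)) // => l; rewrite rmorph0.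
have bpw g : sub b (sub pw g) = sub pt g.
  by rewrite sub_sub; apply: eq_sub => -[s|k] //=; rewrite sub_var.
exists (S + J)%type, (fun j => sub pw (Z j)), (fun s => b (inr s)); split.
- have iWcv g : g \in cvps av -> iW g \in cvps av.
    by move=> gcv; apply: cv_sub => // s; apply: cv_var.
  have atYcv g : g \in cvps av -> atY g \in cvps av.
    move=> gcv; apply: cv_sub => // -[x|j] /=; [exact: cv_var|exact: iWcv].
  have zcv j : zW j \in cvps av by rewrite rpredD ?cvpsC ?cv_var.
  have ucv j : u j \in cvps av.
    rewrite rpredD ?rpredM ?iWcv //; apply: rpred_sum => k _; exact: cv_var.
  have tailcv l : tail l \in cvps av.
    rewrite rpredD ?rpredD ?iWcv //.
      by apply: rpred_sum => j _; rewrite rpredM // atYcv // cv_pder.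
    have [_ _ Fcv] := FE l; apply: cv_sub; first exact: Fcv.
    by move=> [[[x|j]|j]|] /=; rewrite ?iWcv ?cv_var.
  have Phicv i : Phi i \in cvps av.
    rewrite rpredD ?rpredM ?iWcv ?cv_var //.
    by apply: rpred_sum => l _; rewrite rpredM // atYcv.
  move=> j; apply: cv_sub; first by rewrite rpredD ?rpredM ?iWcv.
  by move=> [s|k] /=; [exact: cv_var|exact: wcv].
- by move=> j; rewrite cst_sub.
- by move=> s; apply: b0.
- move=> g [i ->].
  pose G l := sub (cop (fun x => var (inl x)) (fun j => sub pw (Z j))) (f l).
  rewrite -/(G i).
  have GE l : G l = sub pw (sub (cop xW Z) (f l)).
    by rewrite sub_sub; apply: eq_sub => -[x|j] //=; rewrite sub_var.
  pose at_ g := sub pw (atY g).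
  have at_mx (M1 M2 : 'M[ps (X + J)%type]_h) k l :
      at_ ((M1 *m M2) k l) = \sum_m at_ (M1 k m) * at_ (M2 m l).
    by rewrite /at_ atYmx rmorph_sum; apply: eq_bigr => m _; exact: rmorphM.
  have MG k : \sum_l at_ (M k l) * G l = 0.
    have := congr1 (sub pw) (ident k); rewrite rmorph_sum rmorphM /=.
    rewrite -/pw in wPhi; rewrite wPhi mulr0 => sum0.
    rewrite -[RHS]sum0; apply: eq_bigr => l _.
    by rewrite rmorphM /= GE.
  have dG : at_ d * G i = 0.
    transitivity (\sum_k at_ (jac f c i k) * \sum_l at_ (M k l) * G l); last first.
      by rewrite big1 // => k _; rewrite MG mulr0.
    under [RHS]eq_bigr do rewrite mulr_sumr.
    rewrite exchange_big /= (bigD1 i) //= [X in _ = _ + X]big1 => [|l li].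
      have {1}<- : (d%:M : 'M_h) i i = d by rewrite mxE eqxx.
      rewrite addr0 -JM at_mx mulr_suml; apply: eq_bigr => l _.
      by rewrite mulrA.
    transitivity (at_ ((d%:M : 'M_h) i l) * G l).
      rewrite -JM at_mx mulr_suml; apply: eq_bigr => k _.
      by rewrite mulrA.
    by rewrite mxE eq_sym (negPf li) mulr0n /at_ /atY !rmorph0 mul0r.
  case/mps_mul_eq0: dG => // dz.
  have : sub b (at_ d) != 0.
    rewrite /at_ bpw atYE pt_iW dY rmorphM /= mps_mul_neq0 //.
    by apply/eqP => /(congr1 cst); rewrite cst_sub rmorph0; apply/eqP.
  by rewrite dz rmorph0 eqxx.
move=> j; rewrite -(pt_Z j) -bpw; apply: eq_sub => -[x|s] //=.
Qed.

End Newton.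

(** * Descent to one variable less *)

Section WeierstrassStep.
Variables (R : realType) (K : fieldType) (v : K -> R) (av : absolute_value v).
Local Notation ps J := (mps #|(J : finType)| K).

(** Let [abar] be the Weierstrass polynomial of the value [dbar] of [d] at
    [ybar]. Modulo the square of [abar], [ybar] is a polynomial in [z]. That this
    polynomial solves the system modulo the square of [abar], and makes [d]
    divisible by [abar], is a system of convergent equations for the
    coefficients of [abar] and of the polynomial, which are series in the
    variables [X]: the equations are the remainders of Weierstrass divisions by
    the polynomial [AU] with indeterminate coefficients, and they hold at the
    given coefficients by uniqueness of remainders. The hypothesis in the
    variables [X] gives a convergent family of solutions, which is the
    approximate solution required by [newton_step]. *)
Lemma weierstrass_step (X J : finType) h (f : 'I_h -> ps (option X + J)%type)
    (c : 'I_h -> J) (M : 'M[ps (option X + J)%type]_h)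
    (d : ps (option X + J)%type) (ybar : J -> ps (option X)) (e : nat) :
  (forall (J' : finType) (y : J' -> ps X), (forall j, cst (y j) = 0) ->
    solvable av y (vanishing av y)) ->
  (forall j, cst (ybar j) = 0) -> (forall i, vanishing av ybar (f i)) ->
  (forall i k, M i k \in cvps av) -> d \in cvps av ->
  M *m jac f c = d%:M -> jac f c *m M = d%:M ->
  regular (enum_rank (None : option X)) e.+1 (sub (cop var ybar) d) ->
  solvable av ybar (fun g => exists i, g = f i).
Proof.
move=> IH ybar0 fvan Mcv dcv MJ JM dreg.
pose E := e.+1; pose D := (E * 2)%N; pose z : ps (option X) := var None.
have z0 : cst z = 0 by apply: cst_pvar.
set dbar := sub (cop var ybar) d in dreg.
have pt0 s : cst (cop var ybar s) = 0 by case: s => [x|j] //=; apply: cst_pvar.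
have zE0 k : (k < E)%N -> (z ^+ E) (U_(enum_rank (None : option X)) *+ k)%MM = 0.
  by have [low _] := regular_exp K X E; exact: low.
(* the Weierstrass polynomial [abar] of [dbar] *)
have [q [r [zE _]]] := weierstrass_division (z ^+ E) dreg.
have r0 k : cst (r k) = 0.
  have := congr1 (fun g : ps (option X) =>
    g (U_(enum_rank (None : option X)) *+ k)%MM) zE.
  rewrite zE0 ?ltn_ord // coefD (regular_mul_low _ dreg) ?ltn_ord // add0r coef_sum.
  rewrite (bigD1 k) // big1 => [|l lk].
    rewrite [X in _ = X -> _]addr0 coef_up_mulX mulmnE mnm1E eqxx mul1n eqxx.
    rewrite (_ : (_ - _)%MM = 0%MM) => [up0|]; first by rewrite -cst_up /cst -up0.
    by apply/mnmP => i; rewrite mnmBE subnn mnm0E.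
  rewrite coef_up_mulX mulmnE mnm1E eqxx mul1n.
  by rewrite val_eqE eq_sym (negPf lk).
have q0 : cst q != 0.
  have := congr1 (fun g : ps (option X) =>
    g (U_(enum_rank (None : option X)) *+ E)%MM) zE.
  have [_ lead] := regular_exp K X E.
  rewrite coefD (regular_mul_lead _ dreg) coef_sum big1 => [|l _]; last first.
    rewrite coef_up_mulX mulmnE mnm1E eqxx mul1n ifN //.
    by have := ltn_ord l; rewrite /E; lia.
  by rewrite addr0 => zq; apply: contraNneq lead => qz; rewrite zq qz mulr0.
pose a k := - r k; have a0 k : cst (a k) = 0 by rewrite rmorphN /= r0 oppr0.
pose abar := z ^+ E + \sum_k up (a k) * z ^+ k.
have abarE : abar = dbar * q.
  rewrite /abar zE -addrA -big_split big1 ?addr0 // => k _.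
  by rewrite /= rmorphN mulNr subrr.
have up_z0 (g : ps X) : sub (opt z (fun=> 0)) (up g) = mpsC _ (cst g).
  by rewrite sub_up ?sub_zero // => j; rewrite rmorph0.
have abar_reg : regular (enum_rank (None : option X)) D (abar ^+ 2).
  apply: (regular_congr _ (regular_exp K X D)).
  rewrite /D exprM !rmorphXn /=; congr (_ ^+ 2).
  rewrite rmorphD rmorph_sum rmorphXn /= big1 ?addr0 // => k _.
  by rewrite rmorphM /= up_z0 a0 rmorph0 mul0r.
have abar0 : cst abar = 0.
  rewrite rmorphD rmorphXn rmorph_sum /= z0 expr0n add0r big1 // => k _.
  by rewrite rmorphM /= cst_up a0 mul0r.
have dbar_neq0 : dbar != 0.
  by have [_] := dreg; apply: contraNneq => ->.
have abar_neq0 : abar != 0.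
  by rewrite abarE mps_mul_neq0 //; apply: contraNneq q0 => ->; rewrite rmorph0.
(* division of [ybar] by [abar ^+ 2] *)
have [zbar zP] := choice (fun j => weierstrass_division (ybar j) abar_reg).
have [yk ykP] := choice zP.
have yE j : ybar j = abar ^+ 2 * zbar j + \sum_(k < D) up (yk j k) * z ^+ k.
  by have [] := ykP j.
(* the coefficients of the Weierstrass polynomial and of the remainders, moved
   to the origin, are the unknowns in one variable less *)
pose J' := ('I_E + J * 'I_D)%type.
pose eta (p : (J * 'I_D)%type) := yk p.1 p.2 - mpsC _ (cst (yk p.1 p.2)).
pose y' : J' -> ps X := cop a eta.
have y'0 s : cst (y' s) = 0.
  by case: s => [k|p] /=; rewrite ?a0 // rmorphB /= cstC subrr.
have [S [Y' [t' [Ycv Y'0 t'0 Yzero Ybar]]]] := IH J' y' y'0.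
pose U := option (X + J')%type; pose zU : ps U := var None.
have zU0 : cst zU = 0 by apply: cst_pvar.
pose AU : ps U := zU ^+ E + \sum_(k < E) var (Some (inr (inl k))) * zU ^+ k.
pose YU j : ps U := \sum_(k < D)
  (mpsC _ (cst (yk j k)) + var (Some (inr (inr (j, k))))) * zU ^+ k.
pose xU : option X -> ps U := opt zU (fun x => var (Some (inl x))).
have AU_z : sub (opt zU (fun=> 0)) AU = zU ^+ E.
  rewrite rmorphD rmorphXn rmorph_sum /= sub_var //= big1 ?addr0 // => k _.
  by rewrite rmorphM /= sub_var /= ?rmorph0 // mul0r.
have zU_z n : sub (opt zU (fun=> 0)) (zU ^+ n) = zU ^+ n by rewrite rmorphXn /= sub_var.
have AU_reg1 : regular (enum_rank (None : U)) E AU.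
  by apply: (regular_congr _ (regular_exp K _ E)); rewrite AU_z zU_z.
have AU_reg : regular (enum_rank (None : U)) D (AU ^+ 2).
  by apply: (regular_congr _ (regular_exp K _ D)); 
    rewrite zU_z rmorphXn /= AU_z /D exprM.
have AU0 : cst AU = 0.
  rewrite rmorphD rmorphXn rmorph_sum /= zU0 expr0n add0r big1 // => k _.
  by rewrite rmorphM /= cst_pvar mul0r.
have YU0 j : cst (YU j) = 0.
  have := congr1 cst (yE j).
  rewrite ybar0 rmorphD rmorphM rmorphXn /= abar0 expr0n mul0r add0r => sum0.
  rewrite [RHS]sum0 !rmorph_sum; apply: eq_bigr => k _.
  by rewrite !rmorphM !rmorphXn rmorphD /= z0 zU0 cst_up cst_pvar addr0 cstC.
pose pi := cop xU YU.
have pi0 s : cst (pi s) = 0 by case: s => [[x|]|j] //=; apply: cst_pvar.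
have [QF QFP] := choice (fun i => weierstrass_division (sub pi (f i)) AU_reg).
have [RF RFP] := choice QFP.
have [QD [RD [DE DEcv]]] := weierstrass_division (sub pi d) AU_reg1.
(* specialization to [ybar] *)
pose Yb j := \sum_(k < D) up (yk j k) * z ^+ k.
have Yb0 j : cst (Yb j) = 0.
  have := congr1 cst (yE j).
  by rewrite ybar0 rmorphD rmorphM rmorphXn /= abar0 expr0n mul0r add0r.
pose sb : U -> ps (option X) := opt z (fun s => up (cop var y' s)).
have sb0 s : cst (sb s) = 0.
  case: s => [[x|s]|] //=; rewrite cst_up; [exact: cst_pvar|exact: y'0].
have sb_up g : sub sb (up g) = up (sub (cop var y') g).
  rewrite sub_up; last by move=> s; apply: (sb0 (Some s)).
  by rewrite /up sub_sub.
have sb_A : sub sb AU = abar.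
  rewrite rmorphD rmorphXn rmorph_sum /= sub_var //; congr (_ + _).
  by apply: eq_bigr => k _; rewrite rmorphM rmorphXn /= !sub_var.
have sb_Y j : sub sb (YU j) = Yb j.
  rewrite rmorph_sum; apply: eq_bigr => k _.
  rewrite rmorphM rmorphXn rmorphD /= subC !(sub_var (sb0 _)) /=; congr (_ * _).
  by rewrite /eta rmorphB /= [up (mpsC _ _)]subC addrC subrK.
have sb_pi g : sub sb (sub pi g) = sub (cop var Yb) g.
  rewrite sub_sub; apply: eq_sub => -[[x|]|j] /=.
  - by rewrite (sub_var (sb0 _)) /= up_var.
  - by rewrite sub_var.
  - exact: sb_Y.
have ybar_mod (g : ps (option X + J)%type) : exists w,
    sub (cop var ybar) g = sub (cop var Yb) g + abar ^+ 2 * w.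
  have [F [tay _ _]] := taylor2 g; have vx (x : option X) := cst_pvar K x.
  have -> : sub (cop var ybar) g =
      sub (cop var (fun j => Yb j + abar * (abar * zbar j))) g.
    apply: eq_sub => -[x|j] //=; by rewrite yE addrC mulrA -expr2.
  have az j : cst (abar * zbar j) = 0 by rewrite rmorphM /= abar0 mul0r.
  rewrite tay //; set T := sub _ F.
  exists (\sum_j sub (cop var Yb) (pder (inr j) g) * zbar j + T).
  rewrite mulrDr addrA; congr (_ + _ + _); rewrite expr2 -mulrA; congr (_ * _).
  by rewrite mulr_sumr; apply: eq_bigr => j _; rewrite mulrCA.
have RF0 i k : sub (cop var y') (RF i k) = 0.
  have [w] := ybar_mod (f i); have [_ ->] := fvan i; rewrite -sb_pi.
  have [-> _] := RFP i; rewrite rmorphD rmorphM rmorphXn rmorph_sum /= sb_A => H.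
  apply: (weierstrass_remainder abar_reg (q := - sub sb (QF i) - w)
    (c := fun k => sub (cop var y') (RF i k))).
  move/esym/eqP: H; rewrite addrAC -mulrDr addr_eq0 mulrBr mulrN => /eqP.
  move/(congr1 -%R); rewrite opprK mulrDr opprD => ->; apply: eq_bigr => l _.
  by rewrite rmorphM rmorphXn /= sb_up sub_var.
have [wd dbarE] := ybar_mod d; rewrite -/dbar -sb_pi DE in dbarE.
rewrite rmorphD rmorphM rmorph_sum /= sb_A in dbarE.
have RD0 k : sub (cop var y') (RD k) = 0.
  apply: (weierstrass_remainder dreg (q := 1 - q * (sub sb QD + abar * wd))
    (c := fun k => sub (cop var y') (RD k))).
  rewrite mulrBr mulr1 mulrA -abarE {1}dbarE mulrDr mulrA -expr2.
  rewrite opprD addrACA [abar * _ + _]addrC addrK subrr addr0.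
  by apply: eq_bigr => l _; rewrite rmorphM rmorphXn /= sb_up sub_var.
have QD0 : cst QD != 0.
  have H : q * (sub sb QD + abar * wd) = 1.
    apply: (@mps_mulI _ _ dbar) => //; rewrite mulrA -abarE mulr1 mulrDr mulrA -expr2.
    rewrite dbarE big1 ?addr0 // => l _.
    by rewrite rmorphM /= sb_up RD0 rmorph0 mul0r.
  have := congr1 cst H.
  rewrite rmorphM rmorphD rmorphM rmorph1 /= abar0 mul0r addr0 cst_sub.
  by move=> /eqP; apply: contraTneq => ->; rewrite mulr0 eq_sym oner_eq0.
have xUcv x : xU x \in cvps av by case: x => [x|]; apply: cv_var.
have AUcv : AU \in cvps av.
  rewrite rpredD ?rpredX ?cv_var //; apply: rpred_sum => k _.
  by rewrite rpredM ?rpredX ?cv_var.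
have YUcv j : YU j \in cvps av.
  by apply: rpred_sum => k _; rewrite rpredM ?rpredX ?rpredD ?cvpsC ?cv_var.
have picv s : pi s \in cvps av by case: s => [x|j] /=; [exact: xUcv|exact: YUcv].
have QFcv i : QF i \in cvps av /\ forall k, RF i k \in cvps av.
  have [_ cv] := RFP i; apply: cv; last by rewrite rpredX.
  by apply: cv_sub => //; case: (fvan i).
have [QDcv RDcv] : QD \in cvps av /\ forall k, RD k \in cvps av.
  by apply: DEcv => //; apply: cv_sub.
(* specialization to the convergent family *)
pose P := ps (option X + S)%type.
pose emb (g : ps (X + S)%type) : P := sub (fun s : (X + S)%type => match s with
  inl x => var (inl (Some x)) | inr s => var (inr s) end) g.
have emb0 g : cst (emb g) = 0 <-> cst g = 0 by rewrite cst_sub.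
pose Yp := cop (fun x => var (inl x)) Y' : (X + J')%type -> ps (X + S)%type.
have Yp0 s : cst (Yp s) = 0 by case: s => [x|j] //=; apply: cst_pvar.
pose sg : U -> P := opt (var (inl None)) (fun s => emb (Yp s)).
have sg0 s : cst (sg s) = 0 by case: s => [s|] /=; [apply/emb0|apply: cst_pvar].
have sg_up g : sub sg (up g) = emb (sub Yp g).
  rewrite sub_up; last by move=> s; apply: (sg0 (Some s)).
  by rewrite /emb sub_sub.
have sg_pi g : sub sg (sub pi g) =
    sub (cop (fun x => var (inl x)) (fun j => sub sg (YU j))) g.
  rewrite sub_sub; apply: eq_sub => -[[x|]|j] //=; rewrite (sub_var (sg0 _)) //=.
  by rewrite /emb sub_var ?cst_pvar.
pose tb s : ps (option X) := up (t' s).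
have tb0 s : cst (tb s) = 0 by rewrite cst_up.
have var0 (x : option X) : cst (var x : ps (option X)) = 0 by apply: cst_pvar.
have cvtb0 s : cst (cop var tb s) = 0.
  by case: s => [x|l]; [exact: var0|exact: tb0].
have tb_sg g : sub (cop var tb) (sub sg g) = sub sb g.
  rewrite sub_sub; apply: eq_sub => -[s|] /=; last by rewrite sub_var.
  rewrite /emb sub_sub (_ : cop var y' s = sub (cop var t') (Yp s)).
    rewrite /up sub_sub; apply: eq_sub => -[x|l] /=; rewrite (sub_var (cvtb0 _)) //=.
    by rewrite sub_var ?cst_pvar.
  case: s => [x|j] /=; first by rewrite sub_var // cst_pvar.
  by rewrite Ybar.
have sgcv s : sg s \in cvps av.
  case: s => [s|] /=; last exact: cv_var.
  apply: cv_sub; first by case: s => [x|j] /=; [exact: cv_var|exact: Ycv].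
  by case=> *; apply: cv_var.
apply: (@newton_step _ _ _ _ _ _ _ _ _ c M d _ (sub sg AU) (fun j => sub sg (YU j))
  (fun i => sub sg (QF i)) (sub sg QD) tb zbar) => //.
- by move=> i; case: (fvan i).
- exact: cv_sub.
- by move=> j; apply: cv_sub.
- by move=> i; apply: cv_sub => //; case: (QFcv i).
- exact: cv_sub.
- by rewrite cst_sub.
- by move=> j; rewrite cst_sub.
- move=> i; rewrite -sg_pi; have [-> _] := RFP i.
  rewrite rmorphD rmorphM rmorphXn rmorph_sum /= big1 ?addr0 // => k _.
  rewrite rmorphM /= sg_up Yzero ?/emb ?rmorph0 ?mul0r //.
  by split; [case: (QFcv i)|].
- rewrite -sg_pi DE rmorphD rmorphM rmorph_sum /= big1 ?addr0 // => k _.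
  by rewrite rmorphM /= sg_up Yzero ?/emb ?rmorph0 ?mul0r.
- by rewrite cst_sub.
- by rewrite tb_sg sb_A.
- by move=> j; rewrite !tb_sg sb_A sb_Y yE addrC.
- by move=> i; case: (fvan i).
Qed.

End WeierstrassStep.

(** * Induction on the number of variables *)

Section Induction.
Variables (R : realType) (K : fieldType) (v : K -> R) (av : absolute_value v).
Hypothesis charK : [pchar K] =i pred0.
Local Notation ps J := (mps #|(J : finType)| K).

Lemma solvable_sub (X J : finType) (ybar : J -> ps X) (P Q : ps (X + J)%type -> Prop) :
  (forall g, P g -> Q g) -> solvable av ybar Q -> solvable av ybar P.
Proof.
move=> PQ [S [y [t [ycv y0 t0 yQ yE]]]]; exists S, y, t; split=> //.
by move=> g /PQ; apply: yQ.
Qed.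

Definition change_base (X X' J : finType) (phi : X -> ps X') :
    ps (X + J)%type -> ps (X' + J)%type :=
  sub (cop (fun x => sub (fun x => var (inl x)) (phi x)) (fun j => var (inr j))).

Section ChangeBase.
Variables (X X' J : finType) (phi : X -> ps X').
Hypothesis phi0 : forall x, cst (phi x) = 0.

Lemma change_base_cv (g : ps (X + J)%type) :
  (forall x, phi x \in cvps av) -> g \in cvps av -> change_base phi g \in cvps av.
Proof.
move=> phicv gcv; apply: cv_sub => // -[x|j] /=; last exact: cv_var.
by apply: cv_sub => // x'; apply: cv_var.
Qed.

Lemma sub_change_base n (y : J -> mps n K) (x' : X' -> mps n K) g :
  (forall x, cst (x' x) = 0) -> (forall j, cst (y j) = 0) ->
  sub (cop x' y) (change_base phi g) = sub (cop (fun x => sub x' (phi x)) y) g.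
Proof.
move=> x'0 y0; have c0 s : cst (cop x' y s) = 0 by case: s => [x|j] /=.
rewrite sub_sub; apply: eq_sub => -[x|j] /=; last by rewrite (sub_var (c0 _)).
by rewrite sub_sub; apply: eq_sub => s; rewrite (sub_var (c0 _)).
Qed.

Lemma sub_base_change (ybar : J -> ps X) g : (forall j, cst (ybar j) = 0) ->
  sub (cop var (fun j => sub phi (ybar j))) (change_base phi g) =
  sub phi (sub (cop var ybar) g).
Proof.
move=> ybar0; rewrite sub_change_base => [|x|j];
  [|exact: cst_pvar|by rewrite cst_sub ybar0].
rewrite sub_sub; apply: eq_sub => -[x|j] //=.
by rewrite sub_var // sub_id.
Qed.

Lemma pder_change_base k (g : ps (X + J)%type) :
  pder (inr k) (change_base phi g) = change_base phi (pder (inr k) g).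
Proof.
rewrite pder_sub (bigD1 (inr k)) //= big1 => [|[x|j] sk] /=.
- by rewrite pder_var eqxx mulr1 addr0.
- by rewrite pder_sub big1 ?mulr0 // => x' _; rewrite pder_var mulr0.
rewrite pder_var (_ : (inr k == inr j) = false) ?mulr0 //.
by apply: contraNF sk => /eqP [->].
Qed.

Lemma change_base_solvable (ybar : J -> ps X) (P : ps (X + J)%type -> Prop)
    (psi : X' -> ps X) :
  (forall j, cst (ybar j) = 0) ->
  (forall x, cst (psi x) = 0) -> (forall x, psi x \in cvps av) ->
  (forall x, sub psi (phi x) = var x) ->
  solvable av (fun j => sub phi (ybar j))
    (fun g => exists2 f, P f & g = change_base phi f) ->
  solvable av ybar P.
Proof.
move=> ybar0 psi0 psicv psiK [S [y [t [ycv y0 t0 yP yE]]]].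
pose r (s : (X' + S)%type) : ps (X + S)%type := match s with
  | inl x => sub (fun x => var (inl x)) (psi x) | inr l => var (inr l) end.
have r0 s : cst (r s) = 0.
  by case: s => [x|l] /=; rewrite ?cst_sub ?psi0 // cst_pvar.
exists S, (fun j => sub r (y j)), (fun l => sub psi (t l)); split.
- move=> j; apply: cv_sub => // -[x|l] /=; last exact: cv_var.
  by apply: cv_sub => // x'; apply: cv_var.
- by move=> j; rewrite cst_sub.
- by move=> l; rewrite cst_sub.
- move=> f Pf.
  rewrite (_ : sub _ f =
      sub r (sub (cop (fun x => var (inl x)) y) (change_base phi f))).
    by rewrite yP ?rmorph0 //; exists f.
  rewrite sub_change_base ?sub_sub // => [|x]; last exact: cst_pvar.
  apply: eq_sub => -[x|j] //=.
  rewrite sub_sub (_ : sub _ (phi x) = sub (fun x => var (inl x)) (sub psi (phi x))).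
    by rewrite psiK sub_var // cst_pvar.
  by rewrite sub_sub; apply: eq_sub => x'; rewrite (sub_var (r0 _)).
move=> j; transitivity (sub psi (sub phi (ybar j))).
  by rewrite sub_sub -[LHS]sub_id; apply: eq_sub => x; rewrite psiK.
rewrite yE !sub_sub; apply: eq_sub => -[x|l] /=.
  rewrite sub_var // sub_sub -[LHS]sub_id; apply: eq_sub => x'.
  by rewrite sub_var //= cst_pvar.
by rewrite sub_var //= cst_sub.
Qed.

End ChangeBase.

(** After a change of coordinates the Jacobian determinant is regular at the
    formal point; it is inverted, up to a factor, by the adjugate matrix. *)
Lemma solvable_option (X : finType) :
  (forall (J : finType) (y : J -> ps X), (forall j, cst (y j) = 0) ->
    solvable av y (vanishing av y)) ->
  forall (J : finType) (ybar : J -> ps (option X)), (forall j, cst (ybar j) = 0) ->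
    solvable av ybar (vanishing av ybar).
Proof.
move=> IH J ybar ybar0; apply: (solvable_by_system charK) => h f c fvan fc.
have [phi [psi [d [[phi0 psi0] _ psiK reg cv]]]] := regular_coordinates fc.
have [phicv psicv] := cv _ _ av.
apply: (change_base_solvable ybar0 psi0 psicv psiK).
pose f' i := change_base phi (f i).
pose z : ps (option X + J)%type := var (inl None).
have jacE : jac f' c = map_mx (change_base phi) (jac f c).
  by apply/matrixP => i k; rewrite !mxE pder_change_base.
have zcv : z \in cvps av by apply: cv_var.
have f'van i : vanishing av (fun j => sub phi (ybar j)) (f' i).
  have [fcv f0] := fvan i; split; first exact: change_base_cv.
  by rewrite sub_base_change // f0 rmorph0.
have jaccv i k : jac f' c i k \in cvps av.
  by rewrite mxE cv_pder //; case: (f'van i).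
apply: (@solvable_sub _ _ _ _ (fun g => exists i, g = f' i)).
  by move=> g [g' [i ->] ->]; exists i.
(* the factor [z] makes the order positive even when the determinant is a unit *)
apply: (@weierstrass_step _ _ _ _ _ _ _ f' c (z *: \adj (jac f' c))
  (z * \det (jac f' c)) _ d) => //.
- by move=> j; rewrite cst_sub.
- move=> i k; rewrite !mxE rpredM // rpredM //.
    by rewrite rpredX // rpredN rpred1.
  apply: cvps_det => i' k'; rewrite !mxE.
  by have := jaccv (lift k i') (lift i k'); rewrite mxE.
- by rewrite rpredM // cvps_det.
- by rewrite -scalemxAl mul_adj_mx scale_scalar_mx.
- by rewrite -scalemxAr mul_mx_adj scale_scalar_mx.
rewrite rmorphM /= sub_var ?cst_pvar //=; apply: regular_mulz.
rewrite jacE det_map_mx /= sub_base_change //.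
Qed.

Theorem solvable_vanishing (X J : finType) (ybar : J -> ps X) :
  (forall j, cst (ybar j) = 0) -> solvable av ybar (vanishing av ybar).
Proof.
move: {2}#|X| (erefl #|X|) => n; elim: n X J ybar => [|n IH] X J ybar nX ybar0.
  have ybarz j : ybar j = 0.
    apply: mpsP => a; rewrite -[RHS](ybar0 j) /cst; congr (ybar j _).
    by apply/mnmP => i; have := ltn_ord i; rewrite {2}nX.
  exists 'I_0, (fun=> 0), (fun=> 0); split=> [j|j|[]|g [_ g0]|j] //.
  - exact: rpred0.
  - have := congr1 (sub (fun x => var (inl x) : ps (X + 'I_0)%type)) g0.
    rewrite rmorph0 sub_sub => g0'; rewrite -[RHS]g0'; apply: eq_sub => -[x|j] /=.
      by rewrite sub_var // cst_pvar.
    by rewrite ybarz rmorph0.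
  by rewrite ybarz rmorph0.
pose iX x : option 'I_n := unlift ord0 (cast_ord nX (enum_rank x)).
pose jX (o : option 'I_n) : X :=
  enum_val (cast_ord (esym nX) (if o is Some k then lift ord0 k else ord0)).
have iXK x : jX (iX x) = x.
  rewrite /jX /iX; case: unliftP => [k|] E; rewrite -E;
  by rewrite cast_ordK enum_rankK.
have jXcv o : var (jX o) \in cvps av by apply: cv_var.
apply: (@change_base_solvable _ _ _ (fun x => var (iX x)) _ _
  (fun o => var (jX o))) => //.
- by move=> x; apply: cst_pvar.
- by move=> x; rewrite sub_var ?cst_pvar // iXK.
apply: solvable_sub; last first.
  apply: solvable_option => [J' y y0|j]; last by rewrite cst_sub.
  by apply: IH; rewrite ?card_ord.
move=> g [f [fcv f0] ->]; split.
  by apply: change_base_cv => // x; apply: cv_var.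
by rewrite sub_base_change ?f0 ?rmorph0 // => x; apply: cst_pvar.
Qed.

End Induction.

Lemma sub_ev k n (K : fieldType) (J : finType) (h : J -> mps n K)
    (g : 'I_k -> mps #|J| K) (f : mps k K) :
  sub h (ev g f) = ev (fun i => sub h (g i)) f.
Proof. exact: ev_ev. Qed.

Lemma ev_sub k n (K : fieldType) (J : finType) (h : 'I_k -> mps n K)
    (g : J -> mps k K) (f : mps #|J| K) :
  ev h (sub g f) = sub (fun j => ev h (g j)) f.
Proof. exact: ev_ev. Qed.

Theorem mainTheorem1 (R : realType) (K : fieldType) (v : K -> R)
    (charK : [pchar K] =i pred0) (absK : nontrivial_absolute_value v)
    (m n N : nat) (f : 'I_m -> mps (n + N) K) (ybar : 'I_N -> mps n K)
    (f_conv : forall i, convergent v (f i))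
    (ybar0 : forall j, ybar j 0%MM = 0)
    (f_ybar : forall i, mps_subst (f i) (fam_cat (@mps_var n K) ybar) = 0) :
  exists (s : nat) (y : 'I_N -> mps (n + s) K) (tbar : 'I_s -> mps n K),
    (forall j, convergent v (y j)) /\
    (forall j, y j 0%MM = 0) /\
    (forall l, tbar l 0%MM = 0) /\
    (forall i, mps_subst (f i)
       (fam_cat (fun k : 'I_n => mps_var K (lshift s k)) y) = 0) /\
    (forall j, ybar j = mps_subst (y j) (fam_cat (@mps_var n K) tbar)).
Proof.
have [av _] := absK.
pose toX (g : mps n K) : mps #|'I_n| K := ev (fun i => var i) g.
pose ofX : mps #|'I_n| K -> mps n K := sub (@mps_var n K).
have toXK g : ofX (toX g) = g.
  rewrite /ofX /toX sub_ev -[RHS]ev_id; apply: eq_ev => i.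
  by rewrite sub_var // cst_var.
pose yb j := toX (ybar j).
have yb0 j : cst (yb j) = 0 by rewrite cst_ev; apply: ybar0.
pose F i : mps #|(('I_n + 'I_N)%type : finType)| K :=
  ev (fam_cat (fun i => var (inl i)) (fun j => var (inr j))) (f i).
have fam0 k p q (u : 'I_k -> mps q K) (w : 'I_p -> mps q K) i :
    (forall i, cst (u i) = 0) -> (forall j, cst (w j) = 0) -> cst (fam_cat u w i) = 0.
  by move=> u0 w0; rewrite /fam_cat; case: fintype.split.
have [S [y [t [ycv y0 t0 yF yE]]]] := solvable_vanishing av charK yb0.
pose s := #|S|.
pose r (e : ('I_n + S)%type) : mps (n + s) K := match e with
  | inl i => mps_var K (lshift s i)
  | inr u => mps_var K (rshift n (enum_rank u)) end.
have r0 e : cst (r e) = 0 by case: e => *; apply: cst_var.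
exists s, (fun j => sub r (y j)), (fun l => ofX (t (enum_val l))).
have Y0 j : cst (sub r (y j)) = 0 by rewrite cst_sub.
have T0 l : cst (ofX (t (enum_val l))) = 0 by rewrite cst_sub.
split; [|split; [exact: Y0|split; [exact: T0|split]]].
- move=> j; apply/(cvpsP av); apply: cv_sub => // -[i|u]; exact: cvps_var.
- move=> i; rewrite -evE => [|k]; last by apply: fam0 => // k'; apply: cst_var.
  have Fvan : vanishing av yb (F i).
    split; first apply: cvps_ev; first exact/cvpsP.
      by move=> k; rewrite /fam_cat; case: fintype.split => *; apply: cv_var.
    have := congr1 toX (f_ybar i).
    rewrite -evE => [|k]; last by apply: fam0 => // k'; apply: cst_var.
    rewrite /toX rmorph0 ev_ev /F sub_ev => <-; apply: eq_ev => k.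
    rewrite /fam_cat; case: fintype.split => [k'|j].
      by rewrite sub_var ?ev_var ?cst_pvar.
    by rewrite (sub_var (yb0 j : cst (cop _ yb (inr j)) = 0)).
  have := congr1 (sub r) (yF _ Fvan); rewrite rmorph0 => <-.
  rewrite /F !sub_ev; apply: eq_ev => k.
  rewrite /fam_cat; case: fintype.split => [k'|j].
    by rewrite sub_var /= ?cst_pvar // sub_var.
  by rewrite (sub_var (y0 j : cst (cop _ y (inr j)) = 0)).
move=> j; rewrite -evE => [|k]; last by apply: fam0 => // k'; apply: cst_var.
rewrite ev_sub -[LHS]toXK [toX _]yE /ofX sub_sub; apply: eq_sub => -[i|u] /=.
  rewrite sub_var ?cst_var // ev_var /fam_cat.
    by case: split_ordP => k /eqP; rewrite ?eq_lshift ?eq_lrshift // => /eqP ->.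
  by apply: fam0 => // k'; apply: cst_var.
rewrite ev_var; last by apply: fam0 => // k'; apply: cst_var.
rewrite /fam_cat; case: split_ordP => k /eqP; rewrite ?eq_rshift ?eq_rlshift // => /eqP <-.
by rewrite enum_rankK.
Qed.
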